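(* Let $n\in\mathbb{Z}_{\geq1}$, let $D_n^\pm$ be the holomorphic ($+$) or antiholomorphic ($-$) discrete series representation of $\mathrm{PSL}(2,\mathbb{R})$ and let $\pi$ be the derived representation of $\mathfrak{sl}(2,\mathbb{R})$ on the space $C^\infty(D_n^\pm)$ of $C^\infty$ vectors. Let $\varphi\colon C^\infty(D_n^\pm)\to\mathbb{C}$ be a linear map such that $\ker\varphi=\pi(E)C^\infty(D_n^\pm)$ and $\pi(H)\varphi=-\frac{n}{\sqrt2}\varphi$, and let $h\in(D_n^\pm)_{(\pm n)}$ be such that $\varphi(h)=1$. On the complex $C^*\bigl(\mathfrak{an};C^\infty(D_n^\pm)\otimes\mathbb{C}_{\frac{1-n}{\sqrt2}}\bigr)$, with Chevalley--Eilenberg differential $d$, let $$\delta=\iota(E)\otimes T\otimes\mathrm{id},\quad Tf=\pi(E)^{-1}(f-\varphi(f)h),\qquad p=\varepsilon\bigl(\theta_E\pm\sqrt2i\theta_H\bigr)\iota(E)\otimes\varphi h\otimes\mathrm{id}.$$ Then \begin{align*} C^*\Bigl(\mathfrak{an};C^\infty(D_n^\pm)\otimes\mathbb{C}_{\frac{1-n}{\sqrt2}}\Bigr)&=\operatorname{im}p\oplus\operatorname{im}d\oplus\operatorname{im}\delta,\\ \ker d&=\operatorname{im}p\oplus\operatorname{im}d. \end{align*} In particular, $H^*\bigl(\mathfrak{an};C^\infty(D_n^\pm)\otimes\mathbb{C}_{\frac{1-n}{\sqrt2}}\bigr)\simeq\operatorname{im}p$.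
   Context: $H=\frac{1}{2\sqrt{2}}\begin{pmatrix}1&0\\0&-1\end{pmatrix}$, $E=\frac12\begin{pmatrix}0&1\\0&0\end{pmatrix}$, $[H,E]=\frac1{\sqrt2}E$, $\mathfrak{an}=\mathbb{R}H\oplus\mathbb{R}E\subset\mathfrak{sl}(2,\mathbb{R})$, $\theta_H,\theta_E\in\mathfrak{an}^*$ the basis dual to $H,E$. $\mathbb{C}_\lambda$ is the one-dimensional complex representation of $\mathfrak{an}$ with $H\cdot1=\lambda$, $E\cdot1=0$; the complex $C^*(\mathfrak{an};C^\infty(D_n^\pm)\otimes\mathbb{C}_\lambda)$ is regarded as $\bigl(\bigwedge^*(\mathfrak{an}^*\otimes\mathbb{C})\bigr)\otimes C^\infty(D_n^\pm)\otimes\mathbb{C}_\lambda$ (tensor products over $\mathbb{C}$). For $k\in\mathbb{Z}$ let $r_k$ be the character of $\mathrm{PSO}(2)$ with $\exp\theta\begin{pmatrix}0&\frac12\\-\frac12&0\end{pmatrix}\mapsto e^{ik\theta}$, and for a unitary representation $\mathcal{H}$ let $\mathcal{H}_{(k)}$ be its $r_k$-isotypic component. $D_n^+$ (resp. $D_n^-$) is the irreducible unitary representation of $\mathrm{PSL}(2,\mathbb{R})$, unique up to unitary equivalence, with $\dim\mathcal{H}_{(k)}=1$ for $k\geq n$ and $0$ for $k<n$ (resp. $\dim\mathcal{H}_{(k)}=1$ for $k\leq-n$ and $0$ for $k>-n$); these isotypic components consist of $C^\infty$ vectors. Known facts (Flaminio--Forni): $\pi(E)$ is injective on $C^\infty(D_n^\pm)$,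 a $\varphi$ as in the claim exists, and $\varphi\neq0$ on $(D_n^\pm)_{(\pm n)}$, so $h$ exists. Here $(\pi(X)\varphi)(f)=-\varphi(\pi(X)f)$, and $\pi(E)^{-1}$ is defined on $\pi(E)C^\infty(D_n^\pm)=\ker\varphi$. $\varphi h$ denotes the operator $f\mapsto\varphi(f)h$. $\iota(X)$ is the interior product and $\varepsilon(\theta)$ the left exterior multiplication by $\theta$; tensor products of operators are taken without signs. Upper signs correspond to $D_n^+$, lower signs to $D_n^-$. *)

(* Defs.v *)
From HB Require Import structures.
From mathcomp Require Import all_boot all_order all_algebra.
From mathcomp Require Import all_classical all_reals all_analysis.
From mathcomp Require Import complex.

Set Implicit Arguments.
Unset Strict Implicit.
Unset Printing Implicit Defensive.
Import Order.TTheory GRing.Theory Num.Theory.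
Import numFieldNormedType.Exports.
Local Open Scope classical_set_scope.
Local Open Scope ring_scope.
Local Open Scope complex_scope.

Section linear_algebra.
Context {K : pzRingType} {M : lmodType K}.
Implicit Types (A B Z : set M).

Definition internal_dsum (n : nat) (B : 'I_n -> set M) (A : set M) : Prop :=
  [/\ forall i, submod_closed [in B i],
      A = [set \sum_i x i | x in [set x : 'I_n -> M | forall i, B i (x i)]]
    & forall x : 'I_n -> M, (forall i, B i (x i)) ->
        \sum_i x i = 0 -> forall i, x i = 0].

Definition coset B (z : M) : set M := [set z + b | b in B].

Definition quotient_space Z B : set (set M) := [set coset B z | z in Z].

(* For a subspace B, the coset of a *: y + z is the elementwise combination of
   the cosets of y and z, also when a = 0; this expresses linearity of a map
   into a quotient space. *)
Definition linear_into_quotient A (Phi : M -> set M) : Prop :=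
  forall (a : K) (u v : M), A u -> A v ->
    Phi (a *: u + v) = [set a *: x + y | x in Phi u & y in Phi v].

End linear_algebra.

(* A family of forms (c_q)_q, with c_q a V-valued form in q variables in g, is
   encoded by the single function c : seq g -> V, where c [:: X_1; ...; X_q] is
   the value c_q(X_1, ..., X_q). *)

Section forms.
Context {R : realType} {g : lmodType R} {V : lmodType R[i]}.
Implicit Types (c : seq g -> V) (s : seq g) (X : g).

Definition del (i : nat) s : seq g := take i s ++ drop i.+1 s.

Definition multilinear c : Prop :=
  forall s1 s2 (a : R) X Y,
    c (s1 ++ (a *: X + Y) :: s2) =
      a%:C *: c (s1 ++ X :: s2) + c (s1 ++ Y :: s2).

Definition alternating c : Prop := forall s, ~~ uniq s -> c s = 0.

(* When g is finite-dimensional, an alternating c vanishes on sequences longer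
   than dim g, so that this set is the (finite) direct sum over q of the spaces
   Hom_R(/\^q g, W) = /\^q(g^* (x) C) (x)_C W. *)
Definition cochains (W : set V) : set (seq g -> V) :=
  [set c | [/\ multilinear c, alternating c & forall s, W (c s)]].

Definition homogeneous (q : nat) : set (seq g -> V) :=
  [set c | forall s, size s != q -> c s = 0].

(* Chevalley--Eilenberg differential for the bracket br and the action rho. *)
Definition ce_diff (br : g -> g -> g) (rho : g -> V -> V) c : seq g -> V :=
  fun s =>
    \sum_(i < size s) (-1) ^+ i *: rho s`_i (c (del i s)) +
    \sum_(i < size s) \sum_(j < size s | (i < j)%N)
      (-1) ^+ (i + j) *: c (br s`_i s`_j :: del i (del j s)).

Definition interior X c : seq g -> V := fun s => c (X :: s).

Definition exterior (theta : g -> R[i]) c : seq g -> V :=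
  fun s => \sum_(i < size s) (-1) ^+ i *: (theta s`_i *: c (del i s)).

(* The operator id (x) T. *)
Definition on_values (T : V -> V) c : seq g -> V := fun s => T (c s).

End forms.

(* Smooth functions of a real 2 x 2 matrix with values in a complex normed
   space; the difference quotients use the scalars t^-1 seen in R[i]. *)

Section smooth_functions.
Context {R : realType} {V : normedModType R[i]}.
Implicit Types (O : set 'M[R]_2) (f : 'M[R]_2 -> V).

Definition has_dderiv f (x u : 'M[R]_2) (l : V) : Prop :=
  (t^-1)%:C *: (f (x + t *: u) - f x) @[t --> (0 : R)^'] --> l.

Fixpoint Ck_on (k : nat) O f : Prop :=
  (forall x, O x -> f @ x --> f x) /\
  if k is k'.+1 then
    exists g : 'I_2 -> 'I_2 -> 'M[R]_2 -> V, forall i j,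
      (forall x, O x -> has_dderiv f x (delta_mx i j) (g i j x)) /\
      Ck_on k' O (g i j)
  else True.

Definition Cinfty_on O f : Prop := forall k, Ck_on k O f.

(* Smoothness of a function on a subset S of M_2(R), in particular on an
   embedded submanifold: local extendability to smooth functions. *)
Definition smooth_on_subset (S : set 'M[R]_2) f : Prop :=
  forall x, S x -> exists O F,
    [/\ open O, O x, Cinfty_on O F & forall y, O y -> S y -> F y = f y].

End smooth_functions.

Section lie_data.
Context (R : realType).

Definition mx2 (a b c d : R) : 'M[R]_2 :=
  \matrix_(i, j) nth 0 (nth [::] [:: [:: a; b]; [:: c; d]] i) j.

Definition expmx (A : 'M[R]_2) : 'M[R]_2 :=
  limn (series (fun k : nat => (k`!%:R)^-1 *: A ^+ k)).

Definition SL2 : set 'M[R]_2 := [set g | \det g = 1].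

Definition H_mx : 'M[R]_2 := (2 * Num.sqrt 2)^-1 *: mx2 1 0 0 (-1).
Definition E_mx : 'M[R]_2 := 2^-1 *: mx2 0 1 0 0.
Definition so2_gen : 'M[R]_2 := mx2 0 (2^-1) (- 2^-1) 0.

Definition an_basis : 2.-tuple 'M[R]_2 := [tuple H_mx; E_mx].
Definition an_space : {vspace 'M[R]_2} := <<an_basis>>%VS.
Definition an : vectType R := subvs_of an_space.

Definition H_an : an := vsproj an_space H_mx.
Definition E_an : an := vsproj an_space E_mx.

Definition an_bracket (X Y : an) : an :=
  vsproj an_space (vsval X *m vsval Y - vsval Y *m vsval X).

Definition theta_H (X : an) : R := coord an_basis 0 (vsval X).
Definition theta_E (X : an) : R := coord an_basis 1 (vsval X).

Definition expi (x : R) : R[i] := cos x +i* sin x.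

End lie_data.

Section representations.
Context {R : realType} {V : completeNormedModType R[i]}.
Implicit Types (U : 'M[R]_2 -> V -> V) (v : V) (X : 'M[R]_2) (k : int).

(* Inner products are linear in the first variable; together with the
   completeness of V this says that V is a Hilbert space. *)
Definition norm_from_dot (dot : {dot V for @conjc R}) : Prop :=
  forall v, dot v v = `|v| ^+ 2.

(* A representation of PSL(2,R) = SL(2,R) / {1, -1} is a representation of
   SL(2,R) in which -1 acts trivially; U is only relevant on SL(2,R). *)
Record unitary_rep_PSL2 (dot : {dot V for @conjc R}) U : Prop := {
  rep_linear : forall g, SL2 g -> linear (U g);
  rep_one : forall v, U 1 v = v;
  rep_mul : forall g h v, SL2 g -> SL2 h -> U (g *m h) v = U g (U h v);
  rep_minus_one : forall v, U (- 1) v = v;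
  rep_unitary : forall g u v, SL2 g -> dot (U g u) (U g v) = dot u v;
  rep_continuous : forall v, {within @SL2 R, continuous (fun g => U g v)}
}.

Definition irreducible_rep U : Prop :=
  (exists v : V, v != 0) /\
  forall W : set V, closed W -> submod_closed [in W] ->
    (forall g v, SL2 g -> W v -> W (U g v)) ->
    W = [set 0] \/ W = setT.

(* SL(2,R) -> PSL(2,R) is a local diffeomorphism, so smoothness of the orbit map
   may be tested on SL(2,R). *)
Definition smooth_vectors U : set V :=
  [set v | smooth_on_subset (@SL2 R) (fun g => U g v)].

(* The limit exists, and lies in [smooth_vectors U], for v in
   [smooth_vectors U] and X of trace 0. *)
Definition derived_rep U X v : V :=
  lim ((t^-1)%:C *: (U (expmx (t *: X)) v - v) @[t --> (0 : R)^']).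

Definition isotypic U k : set V :=
  [set v | forall theta : R,
     U (expmx (theta *: so2_gen R)) v = expi (k%:~R * theta) *: v].

Definition dim_one (W : set V) : Prop :=
  exists2 v, v != 0 & W = [set a *: v | a in setT].

(* [pos = true] is D_n^+, [pos = false] is D_n^-. *)
Definition discrete_series (pos : bool) (n : nat) (dot : {dot V for @conjc R})
    U : Prop :=
  [/\ unitary_rep_PSL2 dot U, irreducible_rep U
    & if pos then
        (forall k, n%:Z <= k -> dim_one (isotypic U k)) /\
        (forall k, k < n%:Z -> isotypic U k = [set 0])
      else
        (forall k, k <= - n%:Z -> dim_one (isotypic U k)) /\
        (forall k, - n%:Z < k -> isotypic U k = [set 0])].

Definition linear_form_on (W : set V) (phi : V -> R[i]) : Prop :=
  forall a u v, W u -> W v -> phi (a *: u + v) = a * phi u + phi v.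

Definition dual_action U X (phi : V -> R[i]) : V -> R[i] :=
  fun f => - phi (derived_rep U X f).

(* The partially defined inverse of the derived operator of X on smooth
   vectors; the value 0 off its range is a dummy. *)
Definition derived_rep_inv U X v : V :=
  xget 0 [set w | smooth_vectors U w /\ derived_rep U X w = v].

(* Action of [an] on C^infty (x) C_lambda, where f (x) 1 is identified with f. *)
Definition an_action U (lambda : R[i]) (X : an R) v : V :=
  derived_rep U (vsval X) v + (lambda * (theta_H X)%:C) *: v.

Definition an_complex U : set (seq (an R) -> V) := cochains (smooth_vectors U).

Definition an_diff U (lambda : R[i]) : (seq (an R) -> V) -> (seq (an R) -> V) :=
  ce_diff (@an_bracket R) (an_action U lambda).

Definition op_T U (phi : V -> R[i]) (h : V) : V -> V :=
  fun f => derived_rep_inv U (E_mx R) (f - phi f *: h).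

Definition op_delta U phi h (c : seq (an R) -> V) : seq (an R) -> V :=
  on_values (op_T U phi h) (interior (E_an R) c).

Definition theta_pm (pos : bool) (X : an R) : R[i] :=
  (theta_E X)%:C +
  (if pos then 1 else -1) * ((Num.sqrt 2)%:C * 'i%C) * (theta_H X)%:C.

Definition op_p (pos : bool) (phi : V -> R[i]) (h : V) (c : seq (an R) -> V) :
    seq (an R) -> V :=
  exterior (theta_pm pos)
    (on_values (fun f => phi f *: h) (interior (E_an R) c)).

End representations.

(* Main.v *)
Require Import Defs.
From HB Require Import structures.
From mathcomp Require Import all_boot all_order all_algebra.
From mathcomp Require Import all_classical all_reals all_analysis.
From mathcomp Require Import complex.
From mathcomp Require Import ring.
Set Implicit Arguments.
Unset Strict Implicit.
Unset Printing Implicit Defensive.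
Import Order.TTheory GRing.Theory Num.Theory.
Import numFieldNormedType.Exports.
Local Open Scope classical_set_scope.
Local Open Scope ring_scope.
Local Open Scope complex_scope.

(** The Lie algebra an has the basis H, E, so a cochain amounts to a quadruple of
    smooth vectors (f0, fH, fE, f2): its value on the empty sequence, on H, on E
    and on (H, E).  Writing rho(H) = pi(H) + lambda, c = 1 / sqrt 2 and
    kappa = +- sqrt 2 i, the operators become
      d     = (0, rho(H) f0, pi(E) f0, rho(H) fE - pi(E) fH - c fE),
      delta = (T fE, - T f2, 0, 0),
      p     = (0, kappa phi(fE) h, phi(fE) h, phi(f2) h).
    The theorem is formal once one knows that d d = 0, d p = 0, delta p = 0,
    delta delta = 0 and id = p + d delta + delta d.  Indeed these relations give
    d delta d = d and delta d delta = delta, so that d and delta detect the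
    summands im delta and im d; the sum is direct, a closed cochain x is
    p x + d (delta x), and sending p x to its class modulo im d is the
    isomorphism with cohomology.

    The relations follow from the definition of T as an inverse of pi(E) on
    ker phi and from three facts on a unitary representation.

    First, pi(H) pi(E) = pi(E) pi(H) + c pi(E) on smooth vectors.  Differentiating
    exp(tH) exp(sE) = exp(s exp(ct) E) exp(tH) in matrix coefficients gives the
    relation after pairing with any smooth vector; as both sides are smooth, the
    difference may be paired with itself ([bracket_HE]).

    Second, pi(E) is injective ([pE_injective]).  A vector v with pi(E) v = 0 is
    fixed by the unipotent upper triangular group N, so the coefficient
    g |-> <U(g) v, v> is bi-invariant under N; since N g N depends only on the
    lower left entry of g when that entry is not 0, continuity at 1 shows that
    the diagonal group fixes v too, and then all of SL(2,R) does, which is the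
    Mautner phenomenon ([Mautner]).  But for n >= 1 a discrete series has no
    rotation-invariant vector other than 0.

    Third, pi(H) h = kappa pi(E) h + n c h ([extremal_weight]): the lowering
    operator (the raising one for the lower signs) maps h to a weight space
    which is 0.  This is d p = 0 in disguise.

    The derived representation is controlled through local smooth extensions of
    orbit maps: continuous partial derivatives imply differentiability along
    curves ([chain_rule]), by a mean value inequality for curves in a Hilbert
    space, so that X |-> pi(X) v is the restriction of a linear map and the
    orbit map of pi(X) v is again a smooth function. *)

(** * Hilbert space estimates over the reals *)

Section real_norm.
Context {R : realType} {V : normedModType R[i]}.
Implicit Types (u v w : V) (x e : R).

Lemma gt0_realc (e : R[i]) : 0 < e -> exists2 r : R, 0 < r & e = r%:C.
Proof.
move=> e0; exists (complex.Re e); last first.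
  by rewrite [LHS]complexE (ger0_Im (ltW e0)) mulr0 addr0.
by rewrite -ltcR [X in _ < X](_ : _ = e) //
  [RHS]complexE (ger0_Im (ltW e0)) mulr0 addr0.
Qed.

Lemma normc_real x : `|x%:C| = `|x|%:C.
Proof. by rewrite normc_def /= expr0n addr0 sqrtr_sqr. Qed.

(** The norm of V takes values in R[i]; real estimates and the order of R need it
    as a real number. *)
Definition rnorm v : R := complex.Re `|v|.

Lemma rnormE v : `|v| = (rnorm v)%:C.
Proof. by rewrite [LHS]complexE (ger0_Im (normr_ge0 v)) mulr0 addr0. Qed.

Lemma rnorm_ge0 v : 0 <= rnorm v.
Proof. by rewrite -lecR -rnormE normr_ge0. Qed.

Lemma rnorm_eq0 v : (rnorm v == 0) = (v == 0).
Proof.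
by rewrite -(normr_eq0 v) rnormE; apply/eqP/eqP => [->|[]].
Qed.

Lemma rnormD u v : rnorm (u + v) <= rnorm u + rnorm v.
Proof. by rewrite -lecR (rmorphD (real_complex R)) /= -!rnormE ler_normD. Qed.

Lemma rnormN v : rnorm (- v) = rnorm v.
Proof. by rewrite /rnorm normrN. Qed.

Lemma rnormB u v : rnorm (u - v) = rnorm (v - u).
Proof. by rewrite /rnorm distrC. Qed.

Lemma rnormZ x v : rnorm (x%:C *: v) = `|x| * rnorm v.
Proof.
apply: (@complexI R).
by rewrite -rnormE normrZ normc_real rnormE -(rmorphM (real_complex R)).
Qed.

Lemma cvg_rnormP {T : Type} (F : set_system T) {FF : Filter F} (f : T -> V) l :
  f x @[x --> F] --> l <->
  forall e, 0 < e -> \forall x \near F, rnorm (l - f x) < e.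
Proof.
split=> [/cvgrPdist_lt fl e e0|fl].
  have := fl e%:C; rewrite ltcR => /(_ e0).
  by apply: filterS => x; rewrite rnormE ltcR.
apply/cvgrPdist_lt => _ /gt0_realc[e e0 ->].
by apply: filterS (fl e e0) => x; rewrite rnormE ltcR.
Qed.

Lemma cvg_scaler {T : Type} (F : set_system T) {FF : Filter F}
    (s : T -> R) (f : T -> V) (k : R) l :
  s x @[x --> F] --> k -> f x @[x --> F] --> l ->
  (s x)%:C *: f x @[x --> F] --> k%:C *: l.
Proof.
move=> sk fl; apply: (@cvgZ (R[i] : numFieldType)) => //.
apply/cvgrPdist_lt => _ /gt0_realc[e e0 ->].
move/cvgrPdist_lt : sk => /(_ _ e0); apply: filterS => x.
by rewrite -(rmorphB (real_complex R)) normc_real ltcR.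
Qed.

End real_norm.

Section inner_product.
Context {R : realType} {V : completeNormedModType R[i]}.
Variable dot : {dot V for @conjc R}.
Hypothesis dotE : norm_from_dot dot.
Implicit Types u v w : V.

(** Only the real part of the inner product is used: it is bilinear and symmetric
    over R, and a vector orthogonal to itself for it is still 0. *)
Definition rdot u v : R := complex.Re (dot u v).

Lemma dotC u v : dot u v = conjc (dot v u).
Proof. by rewrite hermC expr0 mul1r. Qed.

Lemma rdotC u v : rdot u v = rdot v u.
Proof. by rewrite /rdot dotC; case: (dot v u). Qed.

Lemma rdotDl u v w : rdot (u + v) w = rdot u w + rdot v w.
Proof. by rewrite /rdot linearDl /= raddfD. Qed.

Lemma rdotZl x u w : rdot (x%:C *: u) w = x * rdot u w.
Proof.
by rewrite /rdot linearZl_LR /=; case: (dot u w) => a b /=; rewrite mul0r subr0.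
Qed.

Lemma rdotNl u w : rdot (- u) w = - rdot u w.
Proof. by rewrite /rdot linearNl /= raddfN. Qed.

Lemma rdotBl u v w : rdot (u - v) w = rdot u w - rdot v w.
Proof. by rewrite rdotDl rdotNl. Qed.

Lemma rdotZr x u w : rdot u (x%:C *: w) = x * rdot u w.
Proof. by rewrite rdotC rdotZl rdotC. Qed.

Lemma rdotBr u v w : rdot w (u - v) = rdot w u - rdot w v.
Proof. by rewrite !(rdotC w) rdotBl. Qed.

Lemma rdotvv v : rdot v v = rnorm v ^+ 2.
Proof. by rewrite /rdot dotE rnormE -(rmorphXn (real_complex R)). Qed.

Lemma rdot_CauchySchwarz u v : `|rdot u v| <= rnorm u * rnorm v.
Proof.
have [->|v0] := eqVneq v 0.
  by rewrite rdotC -(scaler0 _ 0%:C) rdotZl mul0r normr0 mulr_ge0 ?rnorm_ge0.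
have nv0 : rnorm v != 0 by rewrite rnorm_eq0.
set a := rdot u v; set n := rnorm v.
have : 0 <= rdot (u - (a / n ^+ 2)%:C *: v) (u - (a / n ^+ 2)%:C *: v).
  by rewrite rdotvv exprn_ge0 // rnorm_ge0.
rewrite !(rdotBl, rdotBr, rdotZl, rdotZr) (rdotC v u) -/a !rdotvv -/n.
rewrite [X in 0 <= X](_ : _ = (rnorm u ^+ 2 * n ^+ 2 - a ^+ 2) / n ^+ 2);
  last by field.
rewrite pmulr_lge0 ?invr_gt0 ?exprn_gt0 // ?lt0r ?nv0 ?rnorm_ge0 //.
rewrite subr_ge0 -exprMn -(real_normK (num_real a)).
by rewrite ler_pXn2r // nnegrE ?mulr_ge0 ?rnorm_ge0.
Qed.

Lemma cvg_rdotl {T : Type} (F : set_system T) {FF : Filter F} (f : T -> V) l w :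
  f x @[x --> F] --> l -> rdot (f x) w @[x --> F] --> rdot l w.
Proof.
move=> /cvg_rnormP fl; apply/cvgrPdist_lt => e e0.
have p0 : 0 < rnorm w + 1 by rewrite ltr_wpDl // rnorm_ge0.
apply: filterS (fl _ (divr_gt0 e0 p0)) => x; rewrite ltr_pdivlMr // => H.
rewrite -rdotBl; apply: le_lt_trans H.
by rewrite (le_trans (rdot_CauchySchwarz _ _)) // ler_wpM2l ?rnorm_ge0 // lerDl.
Qed.

Lemma cvg_rdotr {T : Type} (F : set_system T) {FF : Filter F} (f : T -> V) l w :
  f x @[x --> F] --> l -> rdot w (f x) @[x --> F] --> rdot w l.
Proof.
move=> /cvg_rdotl - /(_ w); rewrite rdotC.
by under eq_fun do rewrite rdotC.
Qed.

End inner_product.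

(** * The mean value inequality for curves in a Hilbert space *)

Section curves.
Context {R : realType} {V : completeNormedModType R[i]}.
Variable dot : {dot V for @conjc R}.
Hypothesis dotE : norm_from_dot dot.

(** The derivative of a curve at t; the real scalar is cast since V is a complex
    space. *)
Definition has_velocity (f : R -> V) (t : R) (l : V) :=
  (s^-1)%:C *: (f (t + s) - f t) @[s --> (0 : R)^'] --> l.

Lemma is_derive_rdot (f : R -> V) (t : R) (l w : V) :
  has_velocity f t l -> is_derive t 1 (fun s => rdot dot (f s) w) (rdot dot l w).
Proof.
move=> fl.
have {}fl : rdot dot ((s^-1)%:C *: (f (t + s) - f t)) w @[s --> (0:R)^']
  --> rdot dot l w by exact: cvg_rdotl.
suff H : h^-1 *: (rdot dot (f (h *: 1 + t)) w - rdot dot (f t) w)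
    @[h --> (0:R)^'] --> rdot dot l w.
  by apply: DeriveDef; [apply/cvg_ex; exists (rdot dot l w)|apply/cvg_lim].
apply: cvg_trans fl; apply: near_eq_cvg; near=> h.
by rewrite rdotZl rdotBl (addrC t h) [h *: 1]mulr1.
Unshelve. all: by end_near. Qed.

Lemma has_velocityB (f g : R -> V) t (l m : V) :
  has_velocity f t l -> has_velocity g t m ->
  has_velocity (fun s => f s - g s) t (l - m).
Proof.
move=> fl gm; apply: cvg_trans (cvgB fl gm); apply: near_eq_cvg; near=> s.
rewrite -[LHS]/(_ *: _ - _ *: _) -scalerBr; congr (_ *: _).
by rewrite !opprD addrACA.
Unshelve. all: by end_near. Qed.

Lemma has_velocity_line (L : V) t : has_velocity (fun s => s%:C *: L) t L.
Proof.
apply/cvg_rnormP => e e0; near=> s.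
have s0 : s != 0 by near: s; exact: nbhs_dnbhs_neq.
rewrite -scalerBl -(rmorphB (real_complex R)) addrAC subrr add0r scalerA.
rewrite -(rmorphM (real_complex R)) mulVf // scale1r subrr.
by have /eqP -> : rnorm (0 : V) == 0 by rewrite rnorm_eq0.
Unshelve. all: by end_near. Qed.

(** With w the vector to be bounded, the real function s |-> <f s - s L, w> has
    increment |w|^2, and by the real mean value theorem and Cauchy-Schwarz this is
    at most e |w|. *)
Lemma mean_value_inequality (f g : R -> V) (L : V) (e : R) :
  (forall t : R, 0 <= t <= 1 -> has_velocity f t (g t)) ->
  (forall t : R, 0 <= t <= 1 -> rnorm (g t - L) <= e) ->
  rnorm (f 1 - f 0 - L) <= e.
Proof.
move=> fg gL; set w := f 1 - f 0 - L.
have e0 : 0 <= e by apply: le_trans (gL 0 _); rewrite ?rnorm_ge0 ?lexx ?ler01.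
pose k (s : R) := rdot dot (f s - s%:C *: L) w.
have dk (t : R) : 0 <= t <= 1 -> is_derive t 1 k (rdot dot (g t - L) w).
  move=> t01; apply: is_derive_rdot.
  by apply: has_velocityB; [exact: fg|exact: has_velocity_line].
have ck : {within `[(0:R), 1], continuous k}.
  apply: derivable_within_continuous => x; rewrite in_itv /= => x01.
  by have [] := dk x x01.
have [//|x|//|c] := @MVT_segment R k (fun t => rdot dot (g t - L) w) 0 1.
  by rewrite in_itv /= => /andP[x0 x1]; apply: dk; rewrite !ltW.
rewrite in_itv /= => c01; rewrite /k -rdotBl subr0 mulr1.
have -> : f 1 - 1%:C *: L - (f 0 - 0%:C *: L) = w.
  by rewrite scale1r scale0r subr0 addrAC.
rewrite (rdotvv dotE) => kE.
have [->|w0] := eqVneq (rnorm w) 0; first by [].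
rewrite -(@ler_pM2r _ (rnorm w)) ?lt0r ?w0 ?rnorm_ge0 // -expr2 kE.
rewrite (le_trans (ler_norm _)) // (le_trans (rdot_CauchySchwarz dotE _ _)) //.
by rewrite ler_wpM2r ?rnorm_ge0 // gL.
Qed.

End curves.

(** * Differentiability of functions of a 2 x 2 matrix *)

#[local] Instance nbhs_mx_filter (R : realType) (x : 'M[R]_2) : Filter (nbhs x) :=
  nbhs_filter x.

Section gradients.
Context {R : realType} {V : completeNormedModType R[i]}.
Variable dot : {dot V for @conjc R}.
Hypothesis dotE : norm_from_dot dot.
Implicit Types (O : set 'M[R]_2) (F : 'M[R]_2 -> V)
  (G : 'I_2 -> 'I_2 -> 'M[R]_2 -> V) (x y A : 'M[R]_2).

Lemma dnbhs0P (P : set R) : (0 : R)^' P <->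
  exists2 e : R, 0 < e & forall s, `|s| < e -> s != 0 -> P s.
Proof.
split=> [/nbhs_ballP[e /= e0 H]|[e e0 H]].
  by exists e => // s se s0; apply: H => //; rewrite /ball /= sub0r normrN.
apply/nbhs_ballP; exists e => //= s; rewrite /ball /= sub0r normrN => se s0.
exact: H.
Qed.

Lemma nbhs_mxP x (P : set 'M[R]_2) : nbhs x P <->
  exists2 e : R, 0 < e &
    forall y, (forall i j, `|y i j - x i j| < e) -> P y.
Proof.
split=> [/nbhs_ballP[e /= e0 H]|[e e0 H]].
  exists e => // y xy; apply: H; split=> // i j.
  by rewrite /ball /= distrC.
apply/nbhs_ballP; exists e => //= y [_ xy]; apply: H => i j.
by rewrite distrC; exact: xy.
Qed.

(** Absorbing the length c into the parameter lets a segment of any sign and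
    length, 0 included, be run through in time 1. *)
Lemma dderiv_velocity F x u (c t : R) l :
  has_dderiv F (x + (t * c) *: u) u l ->
  has_velocity (fun s => F (x + (s * c) *: u)) t (c%:C *: l).
Proof.
have [-> _|c0 /cvg_rnormP Fl] := eqVneq c 0.
  rewrite scale0r; apply: cvg_near_cst; near=> s.
  by rewrite !mulr0 subrr scaler0.
apply/cvg_rnormP => e e0.
have ec : 0 < e / `|c| by rewrite divr_gt0 // normr_gt0.
move: (Fl _ ec) => /dnbhs0P[r r0 H].
apply/dnbhs0P; exists (r / `|c|); first by rewrite divr_gt0 // normr_gt0.
move=> s; rewrite ltr_pdivlMr ?normr_gt0 // -normrM => sr s0.
have := H _ sr (mulf_neq0 s0 c0); rewrite ltr_pdivlMr ?normr_gt0 //.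
rewrite mulrC -rnormZ scalerBr scalerA -(rmorphM (real_complex R)).
by rewrite invfM mulrCA divff // mulr1 -addrA -scalerDl -mulrDl.
Unshelve. all: by end_near. Qed.

Lemma partial_increment O F G x i j (d e : R) y (c : R) :
  (forall x, O x -> has_dderiv F x (delta_mx i j) (G i j x)) ->
  (forall z : 'M[R]_2, (forall k l, `|z k l - x k l| < d) ->
     O z /\ rnorm (G i j z - G i j x) <= e) ->
  (forall s : R, 0 <= s <= 1 ->
     forall k l, `|(y + (s * c) *: delta_mx i j) k l - x k l| < d) ->
  rnorm (F (y + c *: delta_mx i j) - F y - c%:C *: G i j x) <= e * `|c|.
Proof.
move=> FG near_x path.
have := @mean_value_inequality R V dot dotE
  (fun s => F (y + (s * c) *: delta_mx i j))
  (fun s => c%:C *: G i j (y + (s * c) *: delta_mx i j)) (c%:C *: G i j x) (e * `|c|).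
rewrite mul1r mul0r scale0r addr0; apply=> t t01.
  by apply: dderiv_velocity; apply: FG; case: (near_x _ (path _ t01)).
rewrite -scalerBr rnormZ mulrC ler_wpM2r //.
by case: (near_x _ (path _ t01)).
Qed.

Lemma mx2_eta A : A = mx2 (A 0 0) (A 0 1) (A 1 0) (A 1 1).
Proof.
apply/matrixP => i j; rewrite !mxE.
by case: i => [[|[|//]] ?]; case: j => [[|[|//]] ?] /=;
  congr (A _ _); apply: val_inj.
Qed.

Lemma mx2D a b c d a' b' c' d' :
  mx2 a b c d + mx2 a' b' c' d' = mx2 (a + a') (b + b') (c + c') (d + d') :> 'M[R]_2.
Proof.
apply/matrixP => i j; rewrite !mxE.
by case: i => [[|[|//]] ?]; case: j => [[|[|//]] ?].
Qed.

Lemma mx2Z k a b c d :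
  k *: mx2 a b c d = mx2 (k * a) (k * b) (k * c) (k * d) :> 'M[R]_2.
Proof.
apply/matrixP => i j; rewrite !mxE.
by case: i => [[|[|//]] ?]; case: j => [[|[|//]] ?].
Qed.

Lemma mx2M a b c d a' b' c' d' :
  mx2 a b c d *m mx2 a' b' c' d' =
  mx2 (a * a' + b * c') (a * b' + b * d')
      (c * a' + d * c') (c * b' + d * d') :> 'M[R]_2.
Proof.
apply/matrixP => i j; rewrite !mxE !big_ord_recl big_ord0 !mxE /= addr0.
by case: i => [[|[|//]] ?]; case: j => [[|[|//]] ?].
Qed.

Lemma mx2_delta (i j : 'I_2) : delta_mx i j =
  mx2 ((i == 0) && (j == 0))%:R ((i == 0) && (j == 1))%:R
      ((i == 1) && (j == 0))%:R ((i == 1) && (j == 1))%:R :> 'M[R]_2.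
Proof. by rewrite [LHS]mx2_eta !mxE !(eq_sym _ i) !(eq_sym _ j). Qed.

(** The value at A of the total differential at x of a function with partial
    derivatives G. *)
Definition differential G x A : V := \sum_i \sum_j (A i j)%:C *: G i j x.

Lemma differentialE G x A : differential G x A =
  (A 0 0)%:C *: G 0 0 x + (A 0 1)%:C *: G 0 1 x +
  ((A 1 0)%:C *: G 1 0 x + (A 1 1)%:C *: G 1 1 x).
Proof.
rewrite /differential !big_ord_recl !big_ord0 !addr0.
by have -> : lift ord0 ord0 = 1 :> 'I_2 by exact: val_inj.
Qed.

Lemma differential_lin G x (a : R) A B :
  differential G x (a *: A + B) = a%:C *: differential G x A + differential G x B.
Proof.
rewrite /differential scaler_sumr -big_split; apply: eq_bigr => i _.
rewrite scaler_sumr -big_split; apply: eq_bigr => j _.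
rewrite !mxE (rmorphD (real_complex R)) (rmorphM (real_complex R)).
by rewrite scalerDl scalerA.
Qed.

(** One passes from x to y by changing one entry at a time; along each of the four
    segments the partial derivative is close to its value at x, and the mean value
    inequality bounds the error. *)
Lemma total_differential O F G x : open O -> O x ->
  (forall i j y, O y -> has_dderiv F y (delta_mx i j) (G i j y)) ->
  (forall i j, G i j @ x --> G i j x) ->
  forall e : R, 0 < e -> exists2 d : R, 0 < d &
  forall y, (forall i j, `|y i j - x i j| < d) ->
    rnorm (F y - F x - differential G x (y - x)) <=
    e * \sum_i \sum_j `|y i j - x i j|.
Proof.
move=> oO Ox FG cG e e0.
have : nbhs x [set z | O z /\ forall i j, rnorm (G i j z - G i j x) <= e].
  have nO : nbhs x O by exact: open_nbhs_nbhs.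
  suff H : \forall z \near x, forall i j, rnorm (G i j z - G i j x) <= e
    by exact: filterI.
  apply: (@filter_forall _ _ (fun i z => forall j, rnorm (G i j z - G i j x) <= e)
    _ (nbhs_filter x)) => i.
  apply: (@filter_forall _ _ (fun j z => rnorm (G i j z - G i j x) <= e)
    _ (nbhs_filter x)) => j.
  have /cvg_rnormP /(_ _ e0) := cG i j; apply: filterS => z.
  by rewrite rnormB => /ltW.
move=> /nbhs_mxP[d d0 H]; exists d => // y yd.
set v := y - x.
have vE i j : v i j = y i j - x i j by rewrite !mxE.
(* The box spanned by x and y; its corners are the stations of the path. *)
pose pt (a b c d : R) :=
  x + mx2 (a * v 0 0) (b * v 0 1) (c * v 1 0) (d * v 1 1).
have ptd a b c f : 0 <= a <= 1 -> 0 <= b <= 1 -> 0 <= c <= 1 -> 0 <= f <= 1 ->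
    forall k l, `|(pt a b c f) k l - x k l| < d.
  move=> a1 b1 c1 f1 k l; rewrite 2!mxE addrAC subrr add0r.
  have K r (i j : 'I_2) : 0 <= r <= 1 -> `|r * v i j| < d.
    move=> /andP[r0 r1]; apply: le_lt_trans (yd i j); rewrite -vE normrM.
    by rewrite ger0_norm // ler_piMl.
  by case: k => [[|[|//]] ?]; case: l => [[|[|//]] ?] /=; apply: K.
have I0 : 0 <= (0 : R) <= 1 by rewrite lexx ler01.
have I1 : 0 <= (1 : R) <= 1 by rewrite lexx ler01.
have near_x i j (z : 'M[R]_2) : (forall k l, `|z k l - x k l| < d) ->
    O z /\ rnorm (G i j z - G i j x) <= e.
  by move=> /H[Oz K]; split.
have E00 a b c f s :
    pt a b c f + (s * v 0 0) *: delta_mx 0 0 = pt (a + s) b c f.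
  by rewrite /pt -addrA mx2_delta mx2Z mx2D /=; congr (_ + mx2 _ _ _ _); ring.
have E01 a b c f s :
    pt a b c f + (s * v 0 1) *: delta_mx 0 1 = pt a (b + s) c f.
  by rewrite /pt -addrA mx2_delta mx2Z mx2D /=; congr (_ + mx2 _ _ _ _); ring.
have E10 a b c f s :
    pt a b c f + (s * v 1 0) *: delta_mx 1 0 = pt a b (c + s) f.
  by rewrite /pt -addrA mx2_delta mx2Z mx2D /=; congr (_ + mx2 _ _ _ _); ring.
have E11 a b c f s :
    pt a b c f + (s * v 1 1) *: delta_mx 1 1 = pt a b c (f + s).
  by rewrite /pt -addrA mx2_delta mx2Z mx2D /=; congr (_ + mx2 _ _ _ _); ring.
have S00 := @partial_increment O F G x 0 0 d e (pt 0 0 0 0) (v 0 0)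
  (FG 0 0) (near_x 0 0).
rewrite -[X in X *: delta_mx _ _]mul1r E00 add0r in S00.
have {S00}S00 :
    rnorm (F (pt 1 0 0 0) - F (pt 0 0 0 0) - (v 0 0)%:C *: G 0 0 x) <= e * `|v 0 0|.
  by apply: S00 => s s01; rewrite E00 add0r; apply: ptd.
have S01 := @partial_increment O F G x 0 1 d e (pt 1 0 0 0) (v 0 1)
  (FG 0 1) (near_x 0 1).
rewrite -[X in X *: delta_mx _ _]mul1r E01 add0r in S01.
have {S01}S01 :
    rnorm (F (pt 1 1 0 0) - F (pt 1 0 0 0) - (v 0 1)%:C *: G 0 1 x) <= e * `|v 0 1|.
  by apply: S01 => s s01; rewrite E01 add0r; apply: ptd.
have S10 := @partial_increment O F G x 1 0 d e (pt 1 1 0 0) (v 1 0)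
  (FG 1 0) (near_x 1 0).
rewrite -[X in X *: delta_mx _ _]mul1r E10 add0r in S10.
have {S10}S10 :
    rnorm (F (pt 1 1 1 0) - F (pt 1 1 0 0) - (v 1 0)%:C *: G 1 0 x) <= e * `|v 1 0|.
  by apply: S10 => s s01; rewrite E10 add0r; apply: ptd.
have S11 := @partial_increment O F G x 1 1 d e (pt 1 1 1 0) (v 1 1)
  (FG 1 1) (near_x 1 1).
rewrite -[X in X *: delta_mx _ _]mul1r E11 add0r in S11.
have {S11}S11 :
    rnorm (F (pt 1 1 1 1) - F (pt 1 1 1 0) - (v 1 1)%:C *: G 1 1 x) <= e * `|v 1 1|.
  by apply: S11 => s s01; rewrite E11 add0r; apply: ptd.
have yE : y = pt 1 1 1 1.
  by rewrite /pt !mul1r -mx2_eta /v addrC subrK.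
have xE : x = pt 0 0 0 0.
  rewrite /pt !mul0r; apply/matrixP => i j; rewrite !mxE.
  by case: i => [[|[|//]] ?]; case: j => [[|[|//]] ?]; rewrite /= addr0.
rewrite {1}yE {1}xE differentialE.
under eq_bigr do under eq_bigr do rewrite -vE.
rewrite !big_ord_recl !big_ord0 !addr0.
have -> : lift ord0 ord0 = 1 :> 'I_2 by exact: val_inj.
rewrite !mulrDr.
(* Inserting the intermediate point c splits one error term into two. *)
have tele (a b c p q : V) : a - b - (p + q) = (c - b - p) + (a - c - q).
  by rewrite [RHS]addrACA -opprD [c - b + _]addrC addrA subrK.
rewrite (tele _ _ (F (pt 1 1 0 0))) (tele (F (pt 1 1 0 0)) _ (F (pt 1 0 0 0))).
rewrite (tele _ (F (pt 1 1 0 0)) (F (pt 1 1 1 0))).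
apply: le_trans (rnormD _ _) _; apply: lerD; apply: le_trans (rnormD _ _) _;
  exact: lerD.
Qed.

(** By [total_differential] the error is at most e times the sum of the entries of
    gam s - x, which is O(s) as the curve has a velocity at time 0. *)
Lemma chain_rule O F G x (gam : R -> 'M[R]_2) A : open O -> O x ->
  (forall i j y, O y -> has_dderiv F y (delta_mx i j) (G i j y)) ->
  (forall i j, G i j @ x --> G i j x) ->
  (forall i j, s^-1 * (gam s i j - x i j) @[s --> (0 : R)^'] --> A i j) ->
  (s^-1)%:C *: (F (gam s) - F x) @[s --> (0 : R)^'] --> differential G x A.
Proof.
move=> oO Ox FG cG gA.
pose q (s : R) : 'M[R]_2 := s^-1 *: (gam s - x).
have qE s i j : q s i j = s^-1 * (gam s i j - x i j) by rewrite !mxE.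
have qA i j : q s i j @[s --> (0 : R)^'] --> A i j.
  by under eq_fun do rewrite qE; exact: gA.
have dq : differential G x (q s) @[s --> (0 : R)^'] --> differential G x A.
  rewrite differentialE; under eq_fun do rewrite differentialE.
  by apply: cvgD; apply: cvgD; apply: cvg_scaler => //; exact: cvg_cst.
rewrite -[X in _ --> X]add0r.
have : (s^-1)%:C *: (F (gam s) - F x - differential G x (gam s - x))
    @[s --> (0 : R)^'] --> (0 : V).
  apply/cvg_rnormP => e e0.
  (* M exceeds the limit of the sum norm of the quotients q. *)
  pose M := \sum_i \sum_j `|A i j| + 1.
  have M0 : 0 < M by rewrite ltr_wpDl // sumr_ge0 // => i _; rewrite sumr_ge0.
  have qM : \sum_i \sum_j `|q s i j| @[s --> (0 : R)^'] --> \sum_i \sum_j `|A i j|.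
    rewrite !big_ord_recl !big_ord0.
    under eq_fun do rewrite !big_ord_recl !big_ord0.
    by apply: cvgD; [|apply: cvgD; [|exact: cvg_cst]];
      (apply: cvgD; [|apply: cvgD; [|exact: cvg_cst]]); apply: cvg_norm.
  have [d d0 H] := total_differential oO Ox FG cG (divr_gt0 e0 M0).
  have gx : \forall s \near (0 : R)^', forall i j, `|gam s i j - x i j| < d.
    apply: filter_forall => i; apply: filter_forall => j.
    have : s * q s i j @[s --> (0 : R)^'] --> 0 * A i j.
      by apply: cvgM => //; exact: cvg_within.
    rewrite mul0r => /cvgrPdist_lt/(_ _ d0) K; near=> s.
    have s0 : s != 0 by near: s; exact: nbhs_dnbhs_neq.
    have -> : gam s i j - x i j = s * q s i j by rewrite qE mulVKf.
    by rewrite -normrN -sub0r; near: s.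
  have /cvgr_lt - /(_ M) := qM.
  rewrite ltrDl ltr01 => /(_ isT) K.
  near=> s.
  have s0 : s != 0 by near: s; exact: nbhs_dnbhs_neq.
  rewrite sub0r rnormN rnormZ.
  have sq : \sum_i \sum_j `|gam s i j - x i j| = `|s| * \sum_i \sum_j `|q s i j|.
    rewrite mulr_sumr; apply: eq_bigr => i _; rewrite mulr_sumr.
    by apply: eq_bigr => j _; rewrite qE normrM normfV mulVKf // normr_eq0.
  have : `|s^-1| * rnorm (F (gam s) - F x - differential G x (gam s - x))
     <= e / M * \sum_i \sum_j `|q s i j|.
    rewrite normfV ler_pdivrMl ?normr_gt0 // mulrCA -sq; apply: H.
    by near: s.
  move=> /le_lt_trans; apply.
  rewrite -mulrA -[X in _ < X]mulr1 ltr_pM2l // mulrC ltr_pdivrMr // mul1r.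
  by near: s.
move=> /cvgD - /(_ _ _ dq); apply: cvg_trans; apply: near_eq_cvg; near=> s.
have s0 : s != 0 by near: s; exact: nbhs_dnbhs_neq.
rewrite -[LHS]/(_ + _).
have -> : differential G x (q s) = (s^-1)%:C *: differential G x (gam s - x).
  by rewrite -[q s]addr0 differential_lin [X in _ + X](_ : _ = 0) ?addr0 //
    /differential big1 // => i _; rewrite big1 // => j _; rewrite mxE scale0r.
by rewrite -scalerDr subrK.
Unshelve. all: by end_near. Qed.

End gradients.

(** * Calculus of smooth functions of a 2 x 2 matrix *)

Section smooth_calculus.
Context {R : realType} {V : completeNormedModType R[i]}.
Implicit Types (O : set 'M[R]_2) (F f g : 'M[R]_2 -> V)
  (G : 'I_2 -> 'I_2 -> 'M[R]_2 -> V) (x y A : 'M[R]_2).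

Lemma cvg_scalec {T : Type} (F : set_system T) {FF : Filter F} (a : R[i])
    (f : T -> V) (l : V) :
  f x @[x --> F] --> l -> a *: f x @[x --> F] --> a *: l.
Proof. by move=> fl; exact: cvgZl_tmp. Qed.

Lemma Ck_on_sub k O O' f : O' `<=` O -> Ck_on k O f -> Ck_on k O' f.
Proof.
move=> sO; elim: k f => [|k IH] f /= [cf Hf]; split=> //.
- by move=> x /sO; apply: cf.
- by move=> x /sO; apply: cf.
- case: Hf => g Hg; exists g => i j; have [dg Cg] := Hg i j.
  by split=> [x /sO|]; [apply: dg|apply: IH].
Qed.

Lemma Ck_onW k O f : Ck_on k.+1 O f -> Ck_on k O f.
Proof.
elim: k f => [|k IH] f [cf [g Hg]]; split=> //.
by exists g => i j; have [dg Cg] := Hg i j; split=> //; exact: IH.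
Qed.

Lemma has_dderiv_ext f g x u l :
  (\forall y \near x, f y = g y) -> has_dderiv f x u l -> has_dderiv g x u l.
Proof.
move=> fg; apply: cvg_trans; apply: near_eq_cvg.
have ct : x + t *: u @[t --> (0 : R)^'] --> x + 0 *: u.
  apply: cvg_within_filter; apply: cvgD; [exact: cvg_cst|].
  exact: cvgZr_tmp.
rewrite scale0r addr0 in ct.
have xg : f x = g x by exact: nbhs_singleton fg.
have := ct _ fg; rewrite /= => H; near=> t.
by rewrite xg; congr (_ *: (_ - _)); near: t.
Unshelve. all: by end_near. Qed.

Lemma Ck_on_ext k O f g : open O -> (forall x, O x -> f x = g x) ->
  Ck_on k O f -> Ck_on k O g.
Proof.
move=> oO fg.
have nfg x : O x -> \forall y \near x, f y = g y.
  by move=> Ox; apply: filterS (open_nbhs_nbhs (conj oO Ox)) => y /fg.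
have cfg : (forall x, O x -> f @ x --> f x) -> forall x, O x -> g @ x --> g x.
  move=> cf x Ox; rewrite -fg //; apply: cvg_trans (cf x Ox).
  by apply: near_eq_cvg; apply: filterS (nfg x Ox).
case: k => [|k] [cf Hf]; split=> //; try exact: cfg.
case: Hf => h Hh; exists h => i j; have [dh Ch] := Hh i j.
by split=> // x Ox; apply: has_dderiv_ext (dh x Ox); exact: nfg.
Qed.

Lemma has_dderiv_lin (a : R[i]) f g x u l m :
  has_dderiv f x u l -> has_dderiv g x u m ->
  has_dderiv (fun y => a *: f y + g y) x u (a *: l + m).
Proof.
move=> fl gm.
have : a *: ((t^-1)%:C *: (f (x + t *: u) - f x)) +
    (t^-1)%:C *: (g (x + t *: u) - g x) @[t --> (0 : R)^'] --> a *: l + m.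
  by apply: cvgD; [exact: cvg_scalec|].
apply: cvg_trans; apply: near_eq_cvg; near=> t.
rewrite scalerA mulrC -scalerA -scalerDr; congr (_ *: _).
by rewrite scalerBr opprD addrACA.
Unshelve. all: by end_near. Qed.

Lemma Ck_on_lin k O (a : R[i]) f g : Ck_on k O f -> Ck_on k O g ->
  Ck_on k O (fun y => a *: f y + g y).
Proof.
elim: k f g => [|k IH] f g [cf Hf] [cg Hg].
  by split=> // x Ox; apply: cvgD; [apply: cvg_scalec; exact: cf|exact: cg].
split; first by move=> x Ox; apply: cvgD; [apply: cvg_scalec; exact: cf|exact: cg].
case: Hf => f' Hf; case: Hg => g' Hg.
exists (fun i j y => a *: f' i j y + g' i j y) => i j.
have [df Cf] := Hf i j; have [dg Cg] := Hg i j; split; last exact: IH.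
by move=> x Ox; apply: has_dderiv_lin; [exact: df|exact: dg].
Qed.

Lemma Ck_on0 k O : Ck_on k O (fun _ => 0 : V).
Proof.
elim: k => [|k IH]; first by split=> // x _; exact: cvg_cst.
split; first by move=> x _; exact: cvg_cst.
exists (fun _ _ _ => 0) => i j; split=> // x _.
by apply: cvg_near_cst; near=> t; rewrite subrr scaler0.
Unshelve. all: by end_near. Qed.

Lemma Ck_on_sum k O (I : Type) (s : seq I) (f : I -> 'M[R]_2 -> V) :
  (forall i, Ck_on k O (f i)) -> Ck_on k O (fun y => \sum_(i <- s) f i y).
Proof.
move=> Cf; elim: s => [|i s IH].
  have -> : (fun y => \sum_(i <- [::]) f i y) = (fun _ => 0).
    by apply/funext => y; rewrite big_nil.
  exact: Ck_on0.
have -> : (fun y => \sum_(j <- i :: s) f j y) =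
    (fun y => 1 *: f i y + \sum_(j <- s) f j y).
  by apply/funext => y; rewrite big_cons scale1r.
exact: Ck_on_lin.
Qed.

Lemma cvg_entry (i j : 'I_2) x : y i j @[y --> x] --> x i j.
Proof. exact: coord_continuous. Qed.

Lemma has_dderiv_entryM (i j : 'I_2) f x u l : f @ x --> f x ->
  has_dderiv f x u l ->
  has_dderiv (fun y => (y i j)%:C *: f y) x u
    ((x i j)%:C *: l + (u i j)%:C *: f x).
Proof.
move=> cf fl.
have ct : x + t *: u @[t --> (0 : R)^'] --> x.
  have {2}-> : x = x + 0 *: u by rewrite scale0r addr0.
  apply: cvg_within_filter; apply: cvgD; [exact: cvg_cst|].
  exact: cvgZr_tmp.
have fc : f (x + t *: u) @[t --> (0 : R)^'] --> f x by exact: (cvg_comp _ _ ct cf).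
have H1 : (x i j)%:C *: ((t^-1)%:C *: (f (x + t *: u) - f x)) @[t --> (0 : R)^'] -->
    (x i j)%:C *: l.
  by apply: cvg_scalec.
have H2 : (u i j)%:C *: f (x + t *: u) @[t --> (0 : R)^'] --> (u i j)%:C *: f x.
  by apply: cvg_scalec.
have := cvgD H1 H2.
have : (x i j)%:C *: ((t^-1)%:C *: (f (x + t *: u) - f x)) +
    (u i j)%:C *: f (x + t *: u) @[t --> (0 : R)^'] -->
    (x i j)%:C *: l + (u i j)%:C *: f x by exact: cvgD.
move=> + _; apply: cvg_trans; apply: near_eq_cvg; near=> t.
have t0 : t != 0 by near: t; exact: nbhs_dnbhs_neq.
rewrite !mxE (rmorphD (real_complex R)) scalerDl.
rewrite [in RHS]addrAC -scalerBr [RHS]scalerDr !scalerA.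
by rewrite -!(rmorphM (real_complex R)) mulKf // [t^-1 * _]mulrC.
Unshelve. all: by end_near. Qed.

(** The entries of g are the coefficients of the left-invariant vector fields
    g |-> g X, along which orbit maps are differentiated. *)
Lemma Ck_on_entryM k O (i j : 'I_2) f : Ck_on k O f ->
  Ck_on k O (fun y => (y i j)%:C *: f y).
Proof.
elim: k f => [|k IH] f Cf; have [cf Hf] := Cf.
  split=> // x Ox; apply: cvg_scaler; [exact: cvg_entry|exact: cf].
split; first by move=> x Ox; apply: cvg_scaler; [exact: cvg_entry|exact: cf].
case: Hf => f' Hf.
exists (fun k l y =>
  ((delta_mx k l : 'M[R]_2) i j)%:C *: f y + (y i j)%:C *: f' k l y).
move=> p q; have [df Cf'] := Hf p q; split.
  by move=> x Ox; rewrite addrC; apply: has_dderiv_entryM; [exact: cf|exact: df].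
by apply: Ck_on_lin; [exact: Ck_onW|exact: IH].
Qed.

(** Each order of smoothness comes with its own partial derivatives; by uniqueness
    of limits they agree on the open set, so one family serves all orders. *)
Lemma Cinfty_partials O f : open O -> Cinfty_on O f ->
  exists G, forall i j,
    (forall x, O x -> has_dderiv f x (delta_mx i j) (G i j x)) /\
    Cinfty_on O (G i j).
Proof.
move=> oO Cf; have [_ [G HG]] := Cf 1%N; exists G => i j.
have [dG _] := HG i j; split=> // k.
have [_ [H HH]] := Cf k.+1; have [dH CH] := HH i j.
apply: Ck_on_ext CH => // x Ox.
exact: cvg_unique (dH x Ox) (dG x Ox).
Qed.

End smooth_calculus.

(** * Exponentials of upper triangular matrices and rotations *)

Section matrix_curves.
Context {R : realType}.
Implicit Types (a b c d t w : R) (A X g : 'M[R]_2).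

Lemma det_mx2 a b c d : \det (mx2 a b c d) = a * d - b * c.
Proof.
rewrite (expand_det_row _ ord0) !big_ord_recl big_ord0 /cofactor !det_mx11 !mxE /=.
by rewrite expr0 expr1 /= mul1r mulN1r addr0 mulrN.
Qed.

Lemma SL2_mx2 a b c d : SL2 (mx2 a b c d) <-> a * d - b * c = 1.
Proof. by rewrite /SL2 /= det_mx2. Qed.

Lemma SL2_1 : SL2 (1 : 'M[R]_2).
Proof. by rewrite /SL2 /= det1. Qed.

Lemma SL2M A X : SL2 A -> SL2 X -> SL2 (A *m X).
Proof. by rewrite /SL2 /= det_mulmx => -> ->; rewrite mulr1. Qed.

Lemma mx2_1 : 1 = mx2 1 0 0 1 :> 'M[R]_2.
Proof. by rewrite [LHS]mx2_eta !mxE. Qed.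

Lemma cvg_mx2 {T : Type} (F : set_system T) {FF : Filter F}
    (f : T -> 'M[R]_2) (A : 'M[R]_2) :
  (forall i j, f x i j @[x --> F] --> A i j) -> f x @[x --> F] --> A.
Proof.
move=> fA P /nbhs_mxP[e e0 H].
have : \forall x \near F, forall i j, `|f x i j - A i j| < e.
  apply: filter_forall => i; apply: filter_forall => j.
  have /cvgrPdist_lt/(_ _ e0) := fA i j; apply: filterS => x.
  by rewrite distrC.
by apply: filterS => x /H.
Qed.

Lemma expmx_entries A B :
  (forall i j,
    series (fun k => (k`!%:R)^-1 * (A ^+ k) i j) n @[n --> \oo] -->
      (B : 'M[R]_2) i j) ->
  expmx A = B.
Proof.
move=> AB; apply/cvg_lim => //; apply: cvg_mx2 => i j.
apply: cvg_trans (AB i j); apply: near_eq_cvg; near=> n.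
by rewrite /series /= summxE; apply: eq_bigr => k _; rewrite !mxE.
Unshelve. all: by end_near. Qed.

(** The function sinh a / a, extended by continuity at 0. *)
Definition sinhc a : R := if a == 0 then 1 else (expR a - expR (- a)) / (2 * a).

(** The k-th power has upper right entry b u_k with u_(k+1) = a u_k + (- a)^k. *)
Lemma expmx_upper a b :
  expmx (mx2 a b 0 (- a)) = mx2 (expR a) (b * sinhc a) 0 (expR (- a)).
Proof.
pose u k := if a == 0 then (k == 1)%:R else (a ^+ k - (- a) ^+ k) / (2 * a).
have powE k : mx2 a b 0 (- a) ^+ k = mx2 (a ^+ k) (b * u k) 0 ((- a) ^+ k).
  elim: k => [|k IH].
    by rewrite !expr0 mx2_1 /u !expr0 subrr mul0r if_same mulr0.
  rewrite exprS IH -mulmxE mx2M; congr (mx2 _ _ _ _); rewrite ?exprS; try ring.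
  rewrite /u; case: eqVneq => [->|a0].
    rewrite oppr0 mul0r add0r expr0n eqSS.
    by case: (k == 0%N).
  by rewrite !exprS; field.
have ec (x : R) : series (fun k => (k`!%:R)^-1 * x ^+ k) n @[n --> \oo] --> expR x.
  have -> : (fun k => (k`!%:R)^-1 * x ^+ k) = exp_coeff x.
    by apply/funext => k; rewrite /exp_coeff /= mulrC.
  exact: is_cvg_series_exp_coeff.
apply: expmx_entries => i j; under eq_fun do under eq_fun do rewrite powE.
rewrite !mxE; case: i => [[|[|//]] ?]; case: j => [[|[|//]] ?] /=;
  under eq_fun do under eq_fun do rewrite !mxE /=; try exact: ec.
- rewrite /u /sinhc; case: eqVneq => [_|a0].
    rewrite mulr1; apply: cvg_near_cst; exists 2%N => // n /= n2.
    rewrite /series /= big_ltn; last exact: leq_trans n2.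
    rewrite big_ltn // big_nat big1 => [|k /andP[k2 _]].
      by rewrite !mulr0 add0r addr0 mulr1 invr1 mul1r.
    by rewrite gtn_eqF // !mulr0.
  have -> : b * ((expR a - expR (- a)) / (2 * a)) =
      b / (2 * a) * (expR a - expR (- a)) by field.
  have : b / (2 * a) * (series (fun k => (k`!%:R)^-1 * a ^+ k) n -
      series (fun k => (k`!%:R)^-1 * (- a) ^+ k) n) @[n --> \oo] -->
      b / (2 * a) * (expR a - expR (- a)).
    by apply: cvgM; [exact: cvg_cst|apply: cvgB; exact: ec].
  apply: cvg_trans; apply: near_eq_cvg; near=> n.
  rewrite /series /= -sumrB mulr_sumr.
  by apply: eq_bigr => k _; field; rewrite a0 pnatr_eq0 -lt0n fact_gt0.
- rewrite (_ : (fun n => _) = (fun _ => 0)); first exact: cvg_cst.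
  by apply/funext => n; rewrite /series /= big1 // => k _; rewrite mulr0.
Unshelve. all: by end_near. Qed.

Lemma is_derive_quot (f : R -> R) d : is_derive (0 : R) 1 f d ->
  s^-1 * (f s - f 0) @[s --> (0 : R)^'] --> d.
Proof.
move=> [df <-]; apply: cvg_trans df; apply: near_eq_cvg; near=> s.
by rewrite /= addr0 [s *: 1]mulr1.
Unshelve. all: by end_near. Qed.

Lemma quot_expR a : s^-1 * (expR (s * a) - 1) @[s --> (0 : R)^'] --> a.
Proof.
have := @is_derive_quot (fun s => expR (s * a)) a.
rewrite mul0r expR0; apply; apply: is_derive_eq.
by rewrite mul0r expR0 [LHS]mul1r scaler0 add0r [LHS]mulr1.
Qed.

Lemma quot_sin a : s^-1 * sin (s * a) @[s --> (0 : R)^'] --> a.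
Proof.
have H : s^-1 * (sin (s * a) - sin (0 * a)) @[s --> (0 : R)^'] --> a.
  apply: (@is_derive_quot (fun s => sin (s * a))); apply: is_derive_eq.
  by rewrite mul0r cos0 [LHS]mul1r scaler0 add0r [LHS]mulr1.
suff <- : (fun s => s^-1 * (sin (s * a) - sin (0 * a))) =
    (fun s => s^-1 * sin (s * a)) by [].
by apply/funext => s; rewrite mul0r sin0 subr0.
Qed.

Lemma quot_cos a : s^-1 * (cos (s * a) - 1) @[s --> (0 : R)^'] --> (0 : R).
Proof.
have := @is_derive_quot (fun s => cos (s * a)) 0.
rewrite mul0r cos0; apply; apply: is_derive_eq.
by rewrite mul0r sin0 oppr0 [LHS]mul0r.
Qed.

Definition rot w : 'M[R]_2 := mx2 (cos w) (sin w) (- sin w) (cos w).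

(** The entries of the powers of a rotation generator are, up to k!, the Taylor
    coefficients of cos and sin. *)
Lemma expmx_so2 t : expmx (t *: so2_gen R) = rot (t / 2).
Proof.
rewrite /so2_gen mx2Z !mulr0 mulrN; set w := t / 2.
pose c k := cos_coeff w k * k`!%:R; pose s k := sin_coeff w k * k`!%:R.
have f0 k : k`!%:R != 0 :> R by rewrite pnatr_eq0 -lt0n fact_gt0.
have powE k : mx2 0 w (- w) 0 ^+ k = mx2 (c k) (s k) (- s k) (c k).
  rewrite /c /s /cos_coeff /sin_coeff /= !mulfVK //.
  elim: k => [|k IH].
    by rewrite !expr0 mx2_1 /= !mul1r !mul0r oppr0.
  rewrite exprS IH -mulmxE mx2M.
  have [m [->|->]] : exists m, k = m.*2 \/ k = m.*2.+1.
  - exists k./2; rewrite -{1 3}[k]odd_double_half.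
    by case: (odd k); [right|left].
  - rewrite /= odd_double /= uphalf_double doubleK -!exprnP !exprS /=.
    by congr (mx2 _ _ _ _); ring.
  rewrite /= odd_double /= uphalf_double doubleK -!exprnP !exprS /=.
  by congr (mx2 _ _ _ _); ring.
have cc : series (cos_coeff w) n @[n --> \oo] --> cos w.
  by rewrite cos.unlock; exact: is_cvg_series_cos_coeff.
have cs : series (sin_coeff w) n @[n --> \oo] --> sin w.
  by rewrite sin.unlock; exact: is_cvg_series_sin_coeff.
apply: expmx_entries => i j; under eq_fun do under eq_fun do rewrite powE.
rewrite !mxE; case: i => [[|[|//]] ?]; case: j => [[|[|//]] ?] /=;
  under eq_fun do under eq_fun do rewrite !mxE /= /c /s ?mulrN mulrC mulfK //;
  try by [].
have : - series (sin_coeff w) n @[n --> \oo] --> - sin w by exact: cvgN.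
apply: cvg_trans; apply: near_eq_cvg; near=> n.
by rewrite /series /= -sumrN.
Unshelve. all: by end_near. Qed.

End matrix_curves.

(** * Curves in SL(2,R) and their velocities *)

Section tangent_curves.
Context {R : realType}.
Implicit Types (a b c d t w : R) (A X g : 'M[R]_2) (gam : R -> 'M[R]_2).

(** Only the velocity at time 0 is prescribed, so that conjugates of one-parameter
    groups are covered directly. *)
Definition SL2_curve gam X : Prop :=
  (forall s, SL2 (gam s)) /\
  forall i j, s^-1 * (gam s i j - (1 : 'M[R]_2) i j) @[s --> (0 : R)^'] --> X i j.

Lemma entryB A B i j : (A - B) i j = A i j - (B : 'M[R]_2) i j.
Proof. by rewrite !mxE. Qed.

Lemma mulmx2E A B i j :
  (A *m B) i j = A i 0 * B 0 j + A i 1 * (B : 'M[R]_2) 1 j.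
Proof.
rewrite mxE !big_ord_recl big_ord0 addr0.
by have -> : lift ord0 ord0 = 1 :> 'I_2 by exact: val_inj.
Qed.

Lemma SL2_curve_mulmx gam X g : SL2_curve gam X -> forall i j,
  s^-1 * ((g *m gam s) i j - g i j) @[s --> (0 : R)^'] --> (g *m X) i j.
Proof.
move=> [_ gX] i j; rewrite mulmx2E.
have : g i 0 * (s^-1 * (gam s 0 j - (1 : 'M[R]_2) 0 j)) +
    g i 1 * (s^-1 * (gam s 1 j - (1 : 'M[R]_2) 1 j)) @[s --> (0 : R)^'] -->
    g i 0 * X 0 j + g i 1 * X 1 j.
  by apply: cvgD; apply: cvgM; [exact: cvg_cst|exact: gX|exact: cvg_cst|exact: gX].
apply: cvg_trans; apply: near_eq_cvg; near=> s.
have -> : (g *m gam s) i j - g i j = (g *m (gam s - 1)) i j.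
  by rewrite -entryB mulmxBr mulmx1.
by rewrite mulmx2E !entryB; ring.
Unshelve. all: by end_near. Qed.

Lemma SL2_curve_conj gam X g g' : SL2 g -> SL2 g' -> g *m g' = 1 ->
  SL2_curve gam X -> SL2_curve (fun s => g *m gam s *m g') (g *m X *m g').
Proof.
move=> Sg Sg' gg' HX; split=> [s|i j].
  by apply: SL2M => //; apply: SL2M => //; case: HX.
have gX := SL2_curve_mulmx (g := g) HX.
rewrite mulmx2E.
have : (s^-1 * ((g *m gam s) i 0 - g i 0)) * g' 0 j +
    (s^-1 * ((g *m gam s) i 1 - g i 1)) * g' 1 j @[s --> (0 : R)^'] -->
    (g *m X) i 0 * g' 0 j + (g *m X) i 1 * g' 1 j.
  by apply: cvgD; apply: cvgM; [exact: gX|exact: cvg_cst|exact: gX|exact: cvg_cst].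
apply: cvg_trans; apply: near_eq_cvg; near=> s.
have -> : (g *m gam s *m g') i j - (1 : 'M[R]_2) i j = ((g *m gam s - g) *m g') i j.
  by rewrite -entryB mulmxBl gg'.
by rewrite [in RHS]mulmx2E !entryB; ring.
Unshelve. all: by end_near. Qed.

Lemma SL2_curve_upper a b :
  SL2_curve (fun t => expmx (t *: mx2 a b 0 (- a))) (mx2 a b 0 (- a)).
Proof.
have E t : expmx (t *: mx2 a b 0 (- a)) =
    mx2 (expR (t * a)) (t * b * sinhc (t * a)) 0 (expR (t * - a)).
  by rewrite mx2Z mulr0 mulrN expmx_upper.
split=> [t|i j].
  by rewrite E SL2_mx2 mulr0 subr0 mulrN -expRD subrr expR0.
rewrite mx2_1; under eq_fun do rewrite E !mxE; rewrite mxE.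
case: i => [[|[|//]] ?]; case: j => [[|[|//]] ?] /=; try exact: quot_expR.
- have [->|a0] := eqVneq a 0.
    apply: cvg_near_cst; near=> s.
    have s0 : s != 0 by near: s; exact: nbhs_dnbhs_neq.
    by rewrite /sinhc mulr0 eqxx mulr1 subr0 mulKf.
  have : b / (2 * a) * (s^-1 * (expR (s * a) - 1) - s^-1 * (expR (s * - a) - 1))
      @[s --> (0 : R)^'] --> b / (2 * a) * (a - - a).
    by apply: cvgM; [exact: cvg_cst|apply: cvgB; exact: quot_expR].
  rewrite (_ : b / (2 * a) * (a - - a) = b); last by field.
  apply: cvg_trans; apply: near_eq_cvg; near=> s.
  have s0 : s != 0 by near: s; exact: nbhs_dnbhs_neq.
  by rewrite /sinhc mulf_eq0 (negPf s0) (negPf a0) /= mulrN; field; rewrite a0 s0.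
- by apply: cvg_near_cst; near=> s; rewrite subrr mulr0.
Unshelve. all: by end_near. Qed.

Lemma SL2_rot w : SL2 (rot w).
Proof. by rewrite /rot SL2_mx2 mulrN opprK -!expr2 cos2Dsin2. Qed.

Lemma rotV w : rot w *m rot (- w) = 1.
Proof.
rewrite /rot mx2M cosN sinN mx2_1 opprK.
by have := cos2Dsin2 w; rewrite !expr2 => <-; congr (mx2 _ _ _ _); ring.
Qed.

Lemma SL2_curve_so2 : SL2_curve (fun t => expmx (t *: so2_gen R)) (so2_gen R).
Proof.
split=> [t|i j]; first by rewrite expmx_so2; exact: SL2_rot.
rewrite mx2_1; under eq_fun do rewrite expmx_so2 !mxE; rewrite mxE.
case: i => [[|[|//]] ?]; case: j => [[|[|//]] ?] /=; try exact: quot_cos;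
  under eq_fun do rewrite subr0 ?mulrN; try exact: quot_sin.
by apply: cvgN; exact: quot_sin.
Qed.

End tangent_curves.

(** * The derived representation on smooth vectors *)

Section representation.
Context {R : realType} {V : completeNormedModType R[i]}.
Variable dot : {dot V for @conjc R}.
Hypothesis dotE : norm_from_dot dot.
Variable U : 'M[R]_2 -> V -> V.
Hypothesis HU : unitary_rep_PSL2 dot U.
Implicit Types (g X A : 'M[R]_2) (u v w : V) (gam : R -> 'M[R]_2).

Lemma U_lin g a u v : SL2 g -> U g (a *: u + v) = a *: U g u + U g v.
Proof. by move=> Sg; rewrite (rep_linear HU Sg). Qed.

Lemma U_D g u v : SL2 g -> U g (u + v) = U g u + U g v.
Proof. by move=> Sg; have := U_lin 1 u v Sg; rewrite !scale1r. Qed.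

Lemma U_0 g : SL2 g -> U g 0 = 0.
Proof.
move=> Sg; apply: (@addrI _ (U g 0)).
by rewrite -U_D // !addr0.
Qed.

Lemma U_Z g a u : SL2 g -> U g (a *: u) = a *: U g u.
Proof. by move=> Sg; have := U_lin a u 0 Sg; rewrite U_0 // !addr0. Qed.

Lemma U_B g u v : SL2 g -> U g (u - v) = U g u - U g v.
Proof. by move=> Sg; rewrite U_D // -scaleN1r U_Z // scaleN1r. Qed.

Lemma rdot_U g u v : SL2 g -> rdot dot (U g u) (U g v) = rdot dot u v.
Proof. by move=> Sg; rewrite /rdot (rep_unitary HU). Qed.

Lemma rnorm_U g u : SL2 g -> rnorm (U g u) = rnorm u.
Proof.
move=> Sg; apply/eqP; rewrite -(@eqrXn2 _ 2) ?rnorm_ge0 //.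
by rewrite -!(rdotvv dotE) rdot_U.
Qed.

Lemma cvg_U {T : Type} (F : set_system T) {FF : Filter F} g (f : T -> V) (l : V) :
  SL2 g -> f x @[x --> F] --> l -> U g (f x) @[x --> F] --> U g l.
Proof.
move=> Sg /cvg_rnormP fl; apply/cvg_rnormP => e /fl; apply: filterS => x.
by rewrite -U_B // rnorm_U.
Qed.

Lemma smooth0 : smooth_vectors U 0.
Proof.
move=> x Sx; exists setT, (fun _ => 0); split => //; first exact: openT.
- by move=> k; exact: Ck_on0.
- by move=> y _ Sy; rewrite U_0.
Qed.

Lemma smooth_lin a u v : smooth_vectors U u -> smooth_vectors U v ->
  smooth_vectors U (a *: u + v).
Proof.
move=> su sv x Sx.
have [W [F [oO Ox CF FE]]] := su x Sx.
have [W' [F' [oO' Ox' CF' FE']]] := sv x Sx.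
exists (W `&` W'), (fun y => a *: F y + F' y); split => //; first exact: openI.
- move=> k; apply: Ck_on_lin.
    exact: Ck_on_sub (@subIsetl _ _ _) (CF k).
  exact: Ck_on_sub (@subIsetr _ _ _) (CF' k).
- by move=> y [Oy Oy'] Sy; rewrite FE // FE' // U_lin.
Qed.

Lemma smoothZ a u : smooth_vectors U u -> smooth_vectors U (a *: u).
Proof.
by move=> su; rewrite -[a *: u]addr0; apply: smooth_lin => //; exact: smooth0.
Qed.

Lemma smoothD u v : smooth_vectors U u -> smooth_vectors U v ->
  smooth_vectors U (u + v).
Proof. by move=> su sv; rewrite -[u]scale1r; exact: smooth_lin. Qed.

Lemma smoothB u v : smooth_vectors U u -> smooth_vectors U v ->
  smooth_vectors U (u - v).
Proof. by move=> su sv; apply: smoothD => //; rewrite -scaleN1r; exact: smoothZ. Qed.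

Lemma smooth_vectorsP v x : smooth_vectors U v -> SL2 x ->
  exists O F G, [/\ open O, O x,
    (forall y, O y -> SL2 y -> F y = U y v),
    (forall i j y, O y -> has_dderiv F y (delta_mx i j) (G i j y)) &
    (forall i j, Cinfty_on O (G i j))].
Proof.
move=> sv Sx; have [W [F [oO Ox CF FE]]] := sv x Sx.
have [G HG] := Cinfty_partials oO CF; exists W, F, G; split=> //.
  by move=> i j; case: (HG i j).
by move=> i j; case: (HG i j).
Qed.

(** The chain rule for a local smooth extension F of the orbit map; F may be
    replaced by the orbit map as the curve stays in SL(2,R). *)
Lemma orbit_velocity O (F : 'M[R]_2 -> V) G v x gam A : open O -> O x -> SL2 x ->
  (forall y, O y -> SL2 y -> F y = U y v) ->
  (forall i j y, O y -> has_dderiv F y (delta_mx i j) (G i j y)) ->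
  (forall i j, Cinfty_on O (G i j)) ->
  (forall s, SL2 (gam s)) ->
  (forall i j, s^-1 * (gam s i j - x i j) @[s --> (0 : R)^'] --> A i j) ->
  (s^-1)%:C *: (U (gam s) v - U x v) @[s --> (0 : R)^'] --> differential G x A.
Proof.
move=> oO Ox Sx FE FG CG Sgam gA.
have cG i j : G i j @ x --> G i j x by have [+ _] := CG i j 0%N; apply.
have gx : gam s @[s --> (0 : R)^'] --> x.
  apply: cvg_mx2 => i j.
  have : s * (s^-1 * (gam s i j - x i j)) + x i j @[s --> (0 : R)^'] -->
    0 * A i j + x i j.
    apply: cvgD; last exact: cvg_cst.
    by apply: cvgM => //; exact: cvg_within.
  rewrite mul0r add0r; apply: cvg_trans; apply: near_eq_cvg; near=> s.
  have s0 : s != 0 by near: s; exact: nbhs_dnbhs_neq.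
  by rewrite mulVKf // subrK.
have gO : \forall s \near (0 : R)^', O (gam s).
  by apply: gx; exact: open_nbhs_nbhs.
apply: cvg_trans (chain_rule dotE oO Ox FG cG gA).
apply: near_eq_cvg; near=> s.
by rewrite !FE //; near: s.
Unshelve. all: by end_near. Qed.

(** On sl(2,R) the map D is X |-> pi(X) v; elsewhere it is an arbitrary linear
    extension, such as the differential of a smooth extension of the orbit map. *)
Definition orbit_tangent v (D : 'M[R]_2 -> V) : Prop :=
  (forall a A X, D (a *: A + X) = a%:C *: D A + D X) /\
  forall gam X, SL2_curve gam X ->
    (s^-1)%:C *: (U (gam s) v - v) @[s --> (0 : R)^'] --> D X.

Lemma orbit_tangent_ex v : smooth_vectors U v -> exists D, orbit_tangent v D.
Proof.
move=> sv; have [W [F [G [oO O1 FE FG CG]]]] := smooth_vectorsP sv (SL2_1 (R := R)).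
exists (differential G 1); split; first exact: differential_lin.
move=> gam X [Sgam gX].
have := orbit_velocity oO O1 (SL2_1 (R := R)) FE FG CG Sgam gX.
by rewrite (rep_one HU).
Qed.

Lemma orbit_tangent_lin a u v D D' : orbit_tangent u D -> orbit_tangent v D' ->
  orbit_tangent (a *: u + v) (fun X => a *: D X + D' X).
Proof.
move=> [Dl Dv] [Dl' Dv']; split=> [b A X|gam X gX].
  rewrite Dl Dl' !scalerDr !scalerA [a * _]mulrC addrACA.
  by rewrite -!scalerA -!scalerDr.
have : a *: ((s^-1)%:C *: (U (gam s) u - u)) + (s^-1)%:C *: (U (gam s) v - v)
    @[s --> (0 : R)^'] --> a *: D X + D' X.
  by apply: cvgD; [apply: cvg_scalec; exact: Dv|exact: Dv'].
apply: cvg_trans; apply: near_eq_cvg; near=> s.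
rewrite U_lin; last by case: gX.
rewrite scalerA mulrC -scalerA -scalerDr; congr (_ *: _).
by rewrite scalerBr opprD addrACA.
Unshelve. all: by end_near. Qed.

(** U(g) is continuous and linear, so it commutes with the limit that defines D X. *)
Lemma U_tangent g v D gam X : SL2 g -> orbit_tangent v D -> SL2_curve gam X ->
  (s^-1)%:C *: (U (g *m gam s) v - U g v) @[s --> (0 : R)^'] --> U g (D X).
Proof.
move=> Sg [_ Dv] gX.
have : U g ((s^-1)%:C *: (U (gam s) v - v)) @[s --> (0 : R)^'] --> U g (D X).
  by apply: cvg_U => //; exact: Dv.
apply: cvg_trans; apply: near_eq_cvg; near=> s.
by case: gX => SX _; rewrite U_Z // U_B // (rep_mul HU).
Unshelve. all: by end_near. Qed.

Definition upper (a b : R) : 'M[R]_2 := mx2 a b 0 (- a).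

Lemma derived_rep_cvg v D a b : orbit_tangent v D ->
  (t^-1)%:C *: (U (expmx (t *: upper a b)) v - v) @[t --> (0 : R)^'] -->
    D (upper a b).
Proof. by move=> [_ Dv]; apply: Dv; exact: SL2_curve_upper. Qed.

Lemma derived_repE v D a b : orbit_tangent v D ->
  derived_rep U (upper a b) v = D (upper a b).
Proof. by move=> vD; apply/cvg_lim => //; exact: derived_rep_cvg. Qed.

Lemma derived_rep_tangent v a b : smooth_vectors U v ->
  (t^-1)%:C *: (U (expmx (t *: upper a b)) v - v) @[t --> (0 : R)^'] -->
    derived_rep U (upper a b) v.
Proof.
move=> sv; have [D vD] := orbit_tangent_ex sv.
by rewrite (derived_repE a b vD); exact: derived_rep_cvg.
Qed.

(** The orbit map of pi(X) v is the derivative of the orbit map of v along the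
    vector field g |-> g X, and this derivative is the restriction of a smooth
    function of g. *)
Lemma smooth_derived_rep v a b : smooth_vectors U v ->
  smooth_vectors U (derived_rep U (upper a b) v).
Proof.
move=> sv; have [D vD] := orbit_tangent_ex sv; rewrite (derived_repE a b vD).
set X := upper a b => x Sx.
have [W [F [G [oO Ox FE FG CG]]]] := smooth_vectorsP sv Sx.
exists W, (fun y => differential G y (y *m X)); split=> //.
  move=> k; rewrite /differential.
  apply: Ck_on_sum => i; apply: Ck_on_sum => j.
  have -> : (fun y : 'M[R]_2 => ((y *m X) i j)%:C *: G i j y) =
      (fun y => (X 0 j)%:C *: ((y i 0)%:C *: G i j y) +
                ((X 1 j)%:C *: ((y i 1)%:C *: G i j y) + 0)).
    apply/funext => y; rewrite mulmx2E (rmorphD (real_complex R)).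
    rewrite !(rmorphM (real_complex R)) scalerDl addr0.
    by rewrite ![_%:C * (X _ _)%:C]mulrC !scalerA.
  by do 2![apply: Ck_on_lin; first by apply: Ck_on_entryM; exact: CG]; exact: Ck_on0.
move=> y Oy Sy.
have gX : SL2_curve (fun t => expmx (t *: X)) X := SL2_curve_upper a b.
have H1 := U_tangent Sy vD gX.
have H2 := orbit_velocity oO Oy Sy FE FG CG (fun s => SL2M Sy (proj1 gX s))
  (SL2_curve_mulmx (g := y) gX).
exact: cvg_unique H2 H1.
Qed.

Lemma derived_rep_lin a b c u v : smooth_vectors U u -> smooth_vectors U v ->
  derived_rep U (upper a b) (c *: u + v) =
  c *: derived_rep U (upper a b) u + derived_rep U (upper a b) v.
Proof.
move=> /orbit_tangent_ex[D uD] /orbit_tangent_ex[D' vD].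
rewrite (derived_repE a b uD) (derived_repE a b vD).
exact: (derived_repE a b (orbit_tangent_lin c uD vD)).
Qed.

Lemma derived_rep_upper a b a' b' c v : smooth_vectors U v ->
  derived_rep U (upper (c * a + a') (c * b + b')) v =
  c%:C *: derived_rep U (upper a b) v + derived_rep U (upper a' b') v.
Proof.
move=> /orbit_tangent_ex[D vD]; rewrite !(derived_repE _ _ vD).
case: vD => <- _; congr (D _).
by rewrite /upper mx2Z mx2D mulr0 add0r mulrN opprD.
Qed.

End representation.

(** * The bracket relation on smooth vectors *)

Section bracket_relation.
Context {R : realType} {V : completeNormedModType R[i]}.
Variable dot : {dot V for @conjc R}.
Hypothesis dotE : norm_from_dot dot.
Variable U : 'M[R]_2 -> V -> V.
Hypothesis HU : unitary_rep_PSL2 dot U.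
Implicit Types (g X A : 'M[R]_2) (u v w : V) (gam : R -> 'M[R]_2).

Local Notation rt2 := (Num.sqrt 2 : R).
Local Notation pH := (derived_rep U (H_mx R)).
Local Notation pE := (derived_rep U (E_mx R)).

Lemma rt2_neq0 : rt2 != 0.
Proof. by rewrite gt_eqF // sqrtr_gt0. Qed.

Lemma H_mxE : H_mx R = upper (2 * rt2)^-1 0.
Proof. by rewrite /H_mx mx2Z mulr1 mulr0 mulrN mulr1. Qed.

Lemma E_mxE : E_mx R = upper 0 2^-1.
Proof. by rewrite /E_mx mx2Z mulr1 mulr0 /upper oppr0. Qed.

Local Opaque H_mx E_mx.

Lemma expmx_H t :
  expmx (t *: H_mx R) = mx2 (expR (t / (2 * rt2))) 0 0 (expR (- (t / (2 * rt2)))).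
Proof. by rewrite H_mxE mx2Z !mulr0 mulrN expmx_upper mul0r. Qed.

Lemma expmx_nil (t b : R) : expmx (t *: upper 0 b) = mx2 1 (t * b) 0 1.
Proof.
have -> : t *: upper 0 b = mx2 0 (t * b) 0 (- 0).
  by rewrite mx2Z !mulr0 oppr0 mulr0.
by rewrite expmx_upper /sinhc eqxx mulr1 oppr0 expR0.
Qed.

Lemma derived_rep_nil b v : smooth_vectors U v ->
  derived_rep U (upper 0 b) v = (2 * b)%:C *: pE v.
Proof.
move=> sv; rewrite E_mxE.
have D0 : derived_rep U (upper 0 0) v = 0.
  have := derived_rep_upper dotE HU 0 0 0 0 1 sv.
  rewrite mulr0 addr0 scale1r => /eqP.
  by rewrite -subr_eq subrr eq_sym => /eqP.
have := derived_rep_upper dotE HU 0 2^-1 0 0 (2 * b) sv.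
by rewrite D0 !addr0 mulr0 mulrAC divff ?mul1r // pnatr_eq0.
Qed.

Lemma pE_tangent b v : smooth_vectors U v ->
  (s^-1)%:C *: (U (mx2 1 (s * b) 0 1) v - v) @[s --> (0 : R)^'] -->
    (2 * b)%:C *: pE v.
Proof.
move=> sv; rewrite -derived_rep_nil //.
have := derived_rep_tangent (a := 0) (b := b) dotE HU sv.
apply: cvg_trans; apply: near_eq_cvg; near=> s.
by rewrite expmx_nil.
Unshelve. all: by end_near. Qed.

Lemma pH_tangent v : smooth_vectors U v ->
  (t^-1)%:C *: (U (expmx (t *: H_mx R)) v - v) @[t --> (0 : R)^'] --> pH v.
Proof. by move=> sv; rewrite H_mxE; exact: derived_rep_tangent. Qed.

Lemma smooth_pE v : smooth_vectors U v -> smooth_vectors U (pE v).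
Proof. by move=> sv; rewrite E_mxE; exact: (smooth_derived_rep dotE HU). Qed.

Lemma smooth_pH v : smooth_vectors U v -> smooth_vectors U (pH v).
Proof. by move=> sv; rewrite H_mxE; exact: (smooth_derived_rep dotE HU). Qed.

Lemma SL2_expH t : SL2 (expmx (t *: H_mx R)).
Proof. by rewrite expmx_H SL2_mx2 mulr0 subr0 -expRD subrr expR0. Qed.

Lemma SL2_nil b : SL2 (mx2 1 b 0 1 : 'M[R]_2).
Proof. by rewrite SL2_mx2 mulr0 subr0 mulr1. Qed.

(** By unitarity exp(sE) can be moved to w after being moved across exp(tH); so
    the derivative in s falls on v and on w, which are smooth. *)
Lemma adjoint_expH t v w : smooth_vectors U v -> smooth_vectors U w ->
  rdot dot (U (expmx (t *: H_mx R)) (pE v)) w =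
  - (expR (t / rt2) * rdot dot (U (expmx (t *: H_mx R)) v) (pE w)).
Proof.
move=> sv sw; set aH := expmx _; set k := expR (t / rt2).
have Sa : SL2 aH := SL2_expH t.
have H1 : rdot dot (U aH ((s^-1)%:C *: (U (mx2 1 (s * 2^-1) 0 1) v - v))) w
    @[s --> (0 : R)^'] --> rdot dot (U aH (pE v)) w.
  apply: cvg_rdotl => //; apply: cvg_U => //.
  have -> : pE v = (2 * 2^-1)%:C *: pE v.
    by rewrite divff ?scale1r // pnatr_eq0.
  exact: pE_tangent.
have H2 : rdot dot (U aH v) ((s^-1)%:C *: (U (mx2 1 (s * - (k / 2)) 0 1) w - w))
    @[s --> (0 : R)^'] --> - (k * rdot dot (U aH v) (pE w)).
  have -> : - (k * rdot dot (U aH v) (pE w)) =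
      rdot dot (U aH v) ((2 * - (k / 2))%:C *: pE w).
    by rewrite rdotZr mulrN mulrCA divff ?mulr1 ?mulNr // pnatr_eq0.
  by apply: cvg_rdotr => //; exact: pE_tangent.
suff E : (fun s : R =>
      rdot dot (U aH ((s^-1)%:C *: (U (mx2 1 (s * 2^-1) 0 1) v - v))) w) =
    (fun s => rdot dot (U aH v) ((s^-1)%:C *: (U (mx2 1 (s * - (k / 2)) 0 1) w - w))).
  by rewrite E in H1; apply: cvg_unique H1 H2.
apply/funext => s; rewrite (U_Z HU) // (U_B HU) // rdotZl rdotZr rdotBl rdotBr.
congr (_ * (_ - _)).
rewrite -(rep_mul HU) //; last exact: SL2_nil.
have -> : aH *m mx2 1 (s * 2^-1) 0 1 = mx2 1 (s * (k / 2)) 0 1 *m aH.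
  have kE : k = expR (t / (2 * rt2)) * expR (t / (2 * rt2)).
    by rewrite -expRD; congr expR; field; exact: rt2_neq0.
  rewrite /aH expmx_H !mx2M kE expRN.
  congr (mx2 _ _ _ _); field; rewrite ?gt_eqF ?expR_gt0 //.
rewrite (rep_mul HU) //; last exact: SL2_nil.
rewrite -(rdot_U HU _ _ (SL2_nil (s * - (k / 2)))) -(rep_mul HU); try exact: SL2_nil.
rewrite mx2M mulrN; set m := mx2 _ _ _ _.
have -> : m = 1 by rewrite /m mx2_1; congr (mx2 _ _ _ _); ring.
by rewrite (rep_one HU).
Qed.

Lemma pE_skew v w : smooth_vectors U v -> smooth_vectors U w ->
  rdot dot (pE v) w = - rdot dot v (pE w).
Proof.
move=> sv sw; have := adjoint_expH 0 sv sw.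
rewrite expmx_H mul0r oppr0 expR0 -mx2_1 !(rep_one HU) mul0r expR0 mul1r; exact.
Qed.

(** Both sides of [adjoint_expH] are differentiated at t = 0.  The resulting
    relation holds against every smooth w, and the difference of the two sides of
    the claim is itself smooth. *)
Lemma bracket_HE v : smooth_vectors U v ->
  pH (pE v) = rt2^-1%:C *: pE v + pE (pH v).
Proof.
move=> sv; apply/eqP; rewrite -subr_eq0; apply/eqP.
set z := _ - _.
have sz : smooth_vectors U z.
  apply: (smoothB HU); first by apply: smooth_pH; exact: smooth_pE.
  apply: (smoothD HU); last by apply: smooth_pE; exact: smooth_pH.
  by apply: (smoothZ HU); exact: smooth_pE.
suff zw w : smooth_vectors U w -> rdot dot z w = 0.
  apply/eqP; rewrite -rnorm_eq0 -(@eqrXn2 _ 2) ?rnorm_ge0 // expr0n /=.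
  by rewrite -(rdotvv dotE) zw.
move=> sw.
pose aH (t : R) := expmx (t *: H_mx R).
have H1 : rdot dot ((t^-1)%:C *: (U (aH t) (pE v) - pE v)) w
    @[t --> (0 : R)^'] --> rdot dot (pH (pE v)) w.
  by apply: cvg_rdotl => //; apply: pH_tangent; exact: smooth_pE.
have Hv := pH_tangent sv.
have Uv : U (aH t) v @[t --> (0 : R)^'] --> v.
  have : t%:C *: ((t^-1)%:C *: (U (aH t) v - v)) + v @[t --> (0 : R)^'] -->
      0%:C *: pH v + v.
    apply: cvgD; last exact: cvg_cst.
    by apply: cvg_scaler => //; exact: cvg_within.
  rewrite scale0r add0r; apply: cvg_trans; apply: near_eq_cvg; near=> t.
  have t0 : t != 0 by near: t; exact: nbhs_dnbhs_neq.
  by rewrite scalerA -(rmorphM (real_complex R)) divff // scale1r subrK.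
have H2 : - (t^-1 * (expR (t * rt2^-1) - 1) * rdot dot (U (aH t) v) (pE w) +
     rdot dot ((t^-1)%:C *: (U (aH t) v - v)) (pE w)) @[t --> (0 : R)^'] -->
   - (rt2^-1 * rdot dot v (pE w) + rdot dot (pH v) (pE w)).
  apply: cvgN; apply: cvgD; last exact: cvg_rdotl.
  by apply: cvgM; [exact: quot_expR|exact: cvg_rdotl].
have E : (fun t => rdot dot ((t^-1)%:C *: (U (aH t) (pE v) - pE v)) w) =
    (fun t => - (t^-1 * (expR (t * rt2^-1) - 1) * rdot dot (U (aH t) v) (pE w) +
     rdot dot ((t^-1)%:C *: (U (aH t) v - v)) (pE w))).
  apply/funext => t; rewrite !rdotZl !rdotBl adjoint_expH // pE_skew //.
  by rewrite -/(aH t); ring.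
rewrite E in H1.
have EH : rdot dot (pH (pE v)) w =
    - (rt2^-1 * rdot dot v (pE w) + rdot dot (pH v) (pE w)).
  by apply: cvg_unique H1 H2.
have zE (a b c : V) : rdot dot (a - (rt2^-1%:C *: b + c)) w =
    rdot dot a w - (rt2^-1 * rdot dot b w + rdot dot c w).
  by rewrite rdotBl rdotDl rdotZl.
have cancel (k a b c x y : R) :
    a = - (k * x + y) -> b = - x -> c = - y -> a - (k * b + c) = 0.
  by move=> -> -> ->; ring.
rewrite zE; exact: cancel EH (pE_skew sv sw) (pE_skew (smooth_pH sv) sw).
Unshelve. all: by end_near. Qed.

End bracket_relation.

(** * Injectivity of pi(E) *)

Section injectivity.
Context {R : realType} {V : completeNormedModType R[i]}.
Variable dot : {dot V for @conjc R}.
Hypothesis dotE : norm_from_dot dot.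
Variable U : 'M[R]_2 -> V -> V.
Hypothesis HU : unitary_rep_PSL2 dot U.
Implicit Types (g X A : 'M[R]_2) (u v w : V) (gam : R -> 'M[R]_2).

Local Notation rt2 := (Num.sqrt 2 : R).
Local Notation pH := (derived_rep U (H_mx R)).
Local Notation pE := (derived_rep U (E_mx R)).

Local Opaque H_mx E_mx.

Definition nil_mx (b : R) : 'M[R]_2 := mx2 1 b 0 1.
Definition low_mx (b : R) : 'M[R]_2 := mx2 1 0 b 1.
Definition diag_mx2 (a : R) : 'M[R]_2 := mx2 a 0 0 a^-1.

Lemma SL2_low b : SL2 (low_mx b).
Proof. by rewrite SL2_mx2 mul0r subr0 mulr1. Qed.

Lemma SL2_diag a : a != 0 -> SL2 (diag_mx2 a).
Proof. by move=> a0; rewrite SL2_mx2 mul0r subr0 divff. Qed.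

(** The curve s |-> U(exp(sE)) v has velocity U(exp(sE)) (pi(E) v) = 0. *)
Lemma fixed_of_pE_eq0 v : smooth_vectors U v -> pE v = 0 ->
  forall b, U (nil_mx b) v = v.
Proof.
move=> sv Ev b.
have := @mean_value_inequality R V dot dotE (fun s => U (nil_mx (s * b)) v)
  (fun _ => 0) 0 0.
rewrite mul1r mul0r /= => H.
apply/eqP; rewrite -subr_eq0 -rnorm_eq0 eq_le rnorm_ge0 andbT.
have -> : U (nil_mx b) v - v = U (nil_mx b) v - U (nil_mx 0) v - 0.
  by rewrite subr0 /nil_mx -mx2_1 (rep_one HU).
apply: H => t _; last first.
  by have /eqP -> : rnorm (0 - 0 : V) == 0 by rewrite rnorm_eq0 subrr.
have : U (nil_mx (t * b)) ((s^-1)%:C *: (U (nil_mx (s * b)) v - v))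
    @[s --> (0 : R)^'] --> U (nil_mx (t * b)) ((2 * b)%:C *: pE v).
  by apply: cvg_U => //; [exact: SL2_nil|exact: pE_tangent].
rewrite Ev scaler0 (U_0 HU); last exact: SL2_nil.
apply: cvg_trans; apply: near_eq_cvg; near=> s.
rewrite (U_Z HU) ?(U_B HU) -?(rep_mul HU); try exact: SL2_nil.
rewrite mx2M; congr (_ *: (U _ v - _)); rewrite /nil_mx; congr (mx2 _ _ _ _); ring.
Unshelve. all: by end_near. Qed.

Lemma cvg_orbit {T : Type} (F : set_system T) {FF : Filter F}
    (f : T -> 'M[R]_2) x v : SL2 x -> (\forall y \near F, SL2 (f y)) ->
  f y @[y --> F] --> x -> U (f y) v @[y --> F] --> U x v.
Proof.
move=> Sx Sf fx.
have /subspace_continuousP/(_ x Sx) Uc := @rep_continuous _ _ _ _ HU v.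
have fS : f y @[y --> F] --> within (@SL2 R) (nbhs x).
  move=> P /fx /= fP.
  by apply: (@filterS2 _ F _ (fun y => SL2 (f y)) (fun y => SL2 (f y) -> P (f y))
    (fun y => P (f y)) _ Sf fP) => y Sy; apply.
exact: cvg_comp fS Uc.
Qed.

(** The case of equality in Cauchy-Schwarz for a unitary operator. *)
Lemma rdot_fixed g v : SL2 g -> rdot dot (U g v) v = rdot dot v v -> U g v = v.
Proof.
move=> Sg gv; apply/eqP; rewrite -subr_eq0 -rnorm_eq0 -(@eqrXn2 _ 2) ?rnorm_ge0 //.
rewrite expr0n /= -(rdotvv dotE) !rdotBl !rdotBr rdot_U // gv (rdotC dot v) gv.
by rewrite !subrr.
Qed.

(** For a vector fixed by the upper unipotent group N, psi g = <U(g) v, v> is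
    constant on double cosets N g N, and such a coset is determined by the lower
    left entry r of g if r <> 0.  Letting r tend to 0 along matrices with
    diagonal (a, 1/a) gives psi (diag(a, 1/a)) = <v, v>, so diagonal matrices fix
    v; multiplying by them rescales r, hence psi is independent of r, and r -> 0
    gives the value <v, v>. *)
Lemma Mautner v : (forall b, U (nil_mx b) v = v) ->
  forall g, SL2 g -> g 1 0 != 0 -> U g v = v.
Proof.
move=> Nv.
pose psi g := rdot dot (U g v) v.
have psiN b g b' : SL2 g -> psi (nil_mx b *m g *m nil_mx b') = psi g.
  move=> Sg; rewrite /psi !(rep_mul HU) ?Nv //;
    try by [exact: SL2_nil|apply: SL2M => //; exact: SL2_nil].
  rewrite -(rdot_U HU _ _ (SL2_nil (- b))) -(rep_mul HU); try exact: SL2_nil.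
  rewrite mx2M (_ : mx2 _ _ _ _ = 1) ?(rep_one HU) -/(nil_mx (- b)) ?Nv //.
  by rewrite mx2_1; congr (mx2 _ _ _ _); ring.
have psi_low g : SL2 g -> g 1 0 != 0 -> psi g = psi (low_mx (g 1 0)).
  move=> Sg r0.
  rewrite -(psiN ((g 0 0 - 1) / g 1 0) (low_mx (g 1 0)) ((g 1 1 - 1) / g 1 0));
    last exact: SL2_low.
  congr psi; move: Sg r0; rewrite {1 3}[g]mx2_eta SL2_mx2 => Sg r0.
  rewrite /nil_mx /low_mx !mx2M; congr (mx2 _ _ _ _); try by field.
  apply/eqP; rewrite -subr_eq0; apply/eqP.
  transitivity (- (g 0 0 * g 1 1 - g 0 1 * g 1 0 - 1) / g 1 0); first by field.
  by rewrite Sg subrr oppr0 mul0r.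
have cvg_low (h : R -> 'M[R]_2) x : SL2 x ->
    (forall t, t != 0 -> SL2 (h t)) ->
    (forall i j, h t i j @[t --> (0 : R)^'] --> x i j) ->
    psi (h t) @[t --> (0 : R)^'] --> psi x.
  move=> Sx Sh hx; apply: cvg_rdotl => //; apply: cvg_orbit => //.
    by near=> t; apply: Sh; near: t; exact: nbhs_dnbhs_neq.
  exact: cvg_mx2.
have id0 : (t : R) @[t --> (0 : R)^'] --> (0 : R) by exact: cvg_within.
have psi_low_lim : psi (low_mx t) @[t --> (0 : R)^'] --> rdot dot v v.
  have -> : rdot dot v v = psi 1 by rewrite /psi (rep_one HU).
  apply: cvg_low; [exact: SL2_1|by move=> *; exact: SL2_low|move=> i j].
  rewrite mx2_1 mxE; under eq_fun do rewrite mxE.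
  by case: i => [[|[|//]] ?]; case: j => [[|[|//]] ?] /=;
    try exact: cvg_cst; exact: id0.
have psi_diag a : a != 0 -> psi (diag_mx2 a) = rdot dot v v.
  move=> a0.
  have : psi (mx2 a 0 t a^-1) @[t --> (0 : R)^'] --> psi (diag_mx2 a).
    apply: cvg_low; first exact: SL2_diag.
      by move=> t _; rewrite SL2_mx2 mul0r subr0 divff.
    move=> i j; rewrite mxE; under eq_fun do rewrite mxE.
    by case: i => [[|[|//]] ?]; case: j => [[|[|//]] ?] /=;
      try exact: cvg_cst; exact: id0.
  have : psi (mx2 a 0 t a^-1) @[t --> (0 : R)^'] --> rdot dot v v.
    apply: cvg_trans psi_low_lim; apply: near_eq_cvg; near=> t.
    have t0 : t != 0 by near: t; exact: nbhs_dnbhs_neq.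
    by rewrite [RHS]psi_low ?mxE //= SL2_mx2 mul0r subr0 divff.
  by move=> H1 H2; apply: cvg_unique H2 H1.
have diag_fixed a : a != 0 -> U (diag_mx2 a) v = v.
  by move=> a0; apply: rdot_fixed; [exact: SL2_diag|exact: psi_diag].
(* diag(a, 1/a) fixes v, and multiplication by it divides r by a. *)
have psi_scale a r : a != 0 -> r != 0 -> psi (low_mx r) = psi (low_mx (r * a)).
  move=> a0 r0; have ia0 : a^-1 != 0 by rewrite invr_eq0.
  have -> : psi (low_mx (r * a)) = psi (diag_mx2 a^-1 *m low_mx r).
    rewrite [RHS]psi_low; last 2 first.
    - by apply: SL2M; [exact: SL2_diag|exact: SL2_low].
    - by rewrite mx2M mxE /= invrK mul0r add0r mulf_neq0.
    by rewrite mx2M mxE /= invrK mul0r add0r mulrC.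
  rewrite /psi (rep_mul HU); [|exact: SL2_diag|exact: SL2_low].
  rewrite -[in RHS](rdot_U HU _ _ (SL2_diag a0)) (diag_fixed a) //.
  rewrite -(rep_mul HU); [|exact: SL2_diag|exact: SL2_diag].
  rewrite mx2M (_ : mx2 _ _ _ _ = 1) ?(rep_one HU) //.
  by rewrite mx2_1 invrK !mulr0 !mul0r !addr0 add0r divff // mulVf.
move=> g Sg r0; apply: rdot_fixed => //; rewrite -/(psi g) psi_low //.
have : psi (low_mx (g 1 0)) @[t --> (0 : R)^'] --> rdot dot v v.
  have : psi (low_mx (g 1 0 * t)) @[t --> (0 : R)^'] --> rdot dot v v.
    have -> : rdot dot v v = psi 1 by rewrite /psi (rep_one HU).
    apply: cvg_low; [exact: SL2_1|by move=> *; exact: SL2_low|move=> i j].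
    rewrite mx2_1 mxE; under eq_fun do rewrite mxE.
    case: i => [[|[|//]] ?]; case: j => [[|[|//]] ?] //=; try exact: cvg_cst.
    have gt0 : g 1 0 * t @[t --> (0 : R)^'] --> g 1 0 * 0.
      by apply: cvgM; [exact: cvg_cst|exact: cvg_within].
    by rewrite mulr0 in gt0.
  apply: cvg_trans; apply: near_eq_cvg; near=> t.
  have t0 : t != 0 by near: t; exact: nbhs_dnbhs_neq.
  by rewrite -psi_scale.
by move=> /(cvg_unique (@norm_hausdorff _ _)) - /(_ _ (cvg_cst _)) ->.
Unshelve. all: by end_near. Qed.

(** By [Mautner] a vector killed by pi(E) is invariant under all rotations; those
    with lower left entry 0 are 1 and -1, which act trivially. *)
Lemma pE_injective : isotypic U 0 = [set 0] ->
  forall v, smooth_vectors U v -> pE v = 0 -> v = 0.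
Proof.
move=> I0 v sv Ev; have Nv := fixed_of_pE_eq0 sv Ev.
suff : isotypic U 0 v by rewrite I0.
move=> theta; rewrite mulr0z mul0r /expi cos0 sin0 scale1r expmx_so2.
set w := theta / 2.
have [w0|w0] := eqVneq (sin w) 0; last first.
  by apply: (Mautner Nv); [exact: SL2_rot|rewrite mxE /= oppr_eq0].
have /eqP : cos w ^+ 2 = 1 by rewrite -(cos2Dsin2 w) w0 expr0n addr0.
rewrite sqrf_eq1 /rot w0 oppr0 => /orP[] /eqP ->.
  by rewrite -mx2_1 (rep_one HU).
have -> : mx2 (- 1) 0 0 (- 1) = - 1 :> 'M[R]_2.
  by rewrite mx2_1 -[RHS]scaleN1r mx2Z !mulr0 mulr1.
exact: (rep_minus_one HU).
Qed.

End injectivity.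

(** * Vectors of extremal weight *)

Section lowest_weight.
Context {R : realType} {V : completeNormedModType R[i]}.
Variable dot : {dot V for @conjc R}.
Hypothesis dotE : norm_from_dot dot.
Variable U : 'M[R]_2 -> V -> V.
Hypothesis HU : unitary_rep_PSL2 dot U.
Implicit Types (g X A : 'M[R]_2) (u v w : V) (gam : R -> 'M[R]_2).

Local Notation rt2 := (Num.sqrt 2 : R).
Local Notation pH := (derived_rep U (H_mx R)).
Local Notation pE := (derived_rep U (E_mx R)).

Local Opaque H_mx E_mx.

Definition diag_gen : 'M[R]_2 := mx2 2^-1 0 0 (- 2^-1).
Definition sym_gen : 'M[R]_2 := mx2 0 2^-1 2^-1 0.

Lemma H_mx_diag : H_mx R = rt2^-1 *: diag_gen.
Proof.
rewrite H_mxE /upper /diag_gen mx2Z !mulr0 mulrN.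
by congr (mx2 _ _ _ _); rewrite ?invfM 1?mulrC.
Qed.

Lemma sym_genE : sym_gen = 2 *: E_mx R + (- 1) *: so2_gen R.
Proof.
rewrite E_mxE /upper /sym_gen /so2_gen !mx2Z mx2D.
by congr (mx2 _ _ _ _); field.
Qed.

Lemma rot_diag (w : R) : rot w *m diag_gen *m rot (- w) =
  cos (w + w) *: diag_gen + (- sin (w + w)) *: sym_gen.
Proof.
rewrite /rot /diag_gen /sym_gen !mx2M !mx2Z mx2D cosN sinN cosD sinD.
by congr (mx2 _ _ _ _); ring.
Qed.

Lemma rot_sym (w : R) : rot w *m sym_gen *m rot (- w) =
  sin (w + w) *: diag_gen + cos (w + w) *: sym_gen.
Proof.
rewrite /rot /diag_gen /sym_gen !mx2M !mx2Z mx2D cosN sinN cosD sinD.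
by congr (mx2 _ _ _ _); ring.
Qed.

Lemma expiD (a b : R) : expi (a + b) = expi a * expi b.
Proof.
by rewrite /expi cosD sinD; apply/eqP; rewrite eq_complex /=; apply/andP; split;
  apply/eqP; ring.
Qed.

(** This yields the eigenvalue i k of so2_gen on vectors of weight k. *)
Lemma quot_expi (k : R) v :
  (t^-1)%:C *: (expi (k * t) *: v - v) @[t --> (0 : R)^'] --> ('i%C * k%:C) *: v.
Proof.
have : (t^-1 * (cos (t * k) - 1))%:C *: v + (t^-1 * sin (t * k))%:C *: ('i%C *: v)
   @[t --> (0 : R)^'] --> 0%:C *: v + k%:C *: ('i%C *: v).
  apply: cvgD; apply: cvg_scaler; try exact: cvg_cst.
    exact: quot_cos.
  exact: quot_sin.
rewrite scale0r add0r scalerA mulrC; apply: cvg_trans; apply: near_eq_cvg; near=> t.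
rewrite -{4}[v]scale1r -scalerBl !scalerA -scalerDl; congr (_ *: _).
rewrite [k * t]mulrC /expi; apply/eqP; rewrite eq_complex /=.
by apply/andP; split; apply/eqP; ring.
Unshelve. all: by end_near. Qed.

Section weight_vector.
Variables (k : int) (h : V) (D : 'M[R]_2 -> V).
Hypothesis hk : isotypic U k h.
Hypothesis hD : orbit_tangent U h D.

Lemma tangentD A X : D (A + X) = D A + D X.
Proof. by have := (proj1 hD) 1 A X; rewrite !scale1r. Qed.

Lemma tangent0 : D 0 = 0.
Proof. by apply: (@addrI _ (D 0)); rewrite -tangentD !addr0. Qed.

Lemma tangentZ a X : D (a *: X) = a%:C *: D X.
Proof. by have := (proj1 hD) a X 0; rewrite tangent0 !addr0. Qed.

Lemma tangent_so2 : D (so2_gen R) = ('i%C * (k%:~R)%:C) *: h.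
Proof.
have H1 := (proj2 hD) _ _ (SL2_curve_so2 (R := R)).
have H2 : (t^-1)%:C *: (expi (k%:~R * t) *: h - h) @[t --> (0 : R)^'] -->
    ('i%C * (k%:~R)%:C) *: h by exact: quot_expi.
suff E : (fun t => (t^-1)%:C *: (U (expmx (t *: so2_gen R)) h - h)) =
    (fun t => (t^-1)%:C *: (expi (k%:~R * t) *: h - h)).
  by rewrite E in H1; apply: cvg_unique H1 H2.
by apply/funext => t; rewrite hk.
Qed.

(** Conjugating by a rotation, which acts on h by a scalar, moves the velocity X of
    a curve to its image under the adjoint action. *)
Lemma U_rot_tangent (w : R) gam X : SL2_curve gam X ->
  U (rot w) (D X) = expi (k%:~R * (w + w)) *: D (rot w *m X *m rot (- w)).
Proof.
move=> gX; set e := expi _.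
have hw : U (rot w) h = e *: h.
  have ww : (w + w) / 2 = w by field.
  by have := hk (w + w); rewrite expmx_so2 ww.
have H1 := U_tangent dotE HU (SL2_rot w) hD gX.
have H3 : e *: ((s^-1)%:C *: (U (rot w *m gam s *m rot (- w)) h - h))
    @[s --> (0 : R)^'] --> e *: D (rot w *m X *m rot (- w)).
  apply: cvg_scalec; apply: (proj2 hD).
  exact: SL2_curve_conj (SL2_rot w) (SL2_rot (- w)) (rotV w) gX.
suff E : (fun s => (s^-1)%:C *: (U (rot w *m gam s) h - U (rot w) h)) =
    (fun s => e *: ((s^-1)%:C *: (U (rot w *m gam s *m rot (- w)) h - h))).
  by rewrite E in H1; apply: cvg_unique H1 H3.
apply/funext => s; have Sg : SL2 (gam s) by case: gX.
have Sc : SL2 (rot w *m gam s *m rot (- w)).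
  by do 2![apply: SL2M => //; try exact: SL2_rot].
have gE : U (rot w *m gam s) h = e *: U (rot w *m gam s *m rot (- w)) h.
  rewrite -(U_Z HU) // -hw -(rep_mul HU) //; last exact: SL2_rot.
  have Vrot : rot (- w) *m rot w = 1 by rewrite -{2}[w]opprK rotV.
  by rewrite -mulmxA Vrot mulmx1.
by rewrite gE hw -scalerBr !scalerA [e * _]mulrC.
Qed.

(** Rotations act on the span of diag_gen and sym_gen by plane rotations, with
    eigenvectors diag_gen -+ i sym_gen of weight -+ 1. *)
Lemma weight_shift (e : R) : e ^+ 2 = 1 ->
  let z := D diag_gen - (e%:C * 'i%C) *: D sym_gen in
  forall theta : R,
    U (expmx (theta *: so2_gen R)) z = expi ((k%:~R - e) * theta) *: z.
Proof.
move=> e1 z theta; rewrite expmx_so2; set w := theta / 2.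
have tw : theta = w + w by rewrite /w -splitr.
have cS : SL2_curve (fun t => expmx (t *: upper 2^-1 0)) diag_gen.
  exact: SL2_curve_upper.
have cE : SL2_curve (fun t => expmx (t *: E_mx R)) (E_mx R).
  by rewrite E_mxE; exact: SL2_curve_upper.
have Srot := SL2_rot w.
have UB : U (rot w) (D sym_gen) =
    expi (k%:~R * (w + w)) *: D (rot w *m sym_gen *m rot (- w)).
  rewrite sym_genE tangentD (tangentZ 2) (tangentZ (-1)) (U_D HU) // !(U_Z HU) //.
  rewrite (U_rot_tangent w cE) (U_rot_tangent w (SL2_curve_so2 (R := R))).
  rewrite mulmxDr mulmxDl -!scalemxAr -!scalemxAl tangentD.
  rewrite (tangentZ 2) (tangentZ (-1)).
  by rewrite scalerDr !scalerA ![_%:C * expi _]mulrC.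
rewrite /z (U_B HU) // (U_Z HU) // UB (U_rot_tangent w cS) rot_diag rot_sym.
rewrite !tangentD !tangentZ -tw mulrBl expiD.
have es : e = 1 \/ e = - 1.
  by move/eqP: e1; rewrite sqrf_eq1 => /orP[] /eqP ->; [left|right].
have -> : expi (- (e * theta)) = (cos theta)%:C - e%:C * 'i%C * (sin theta)%:C.
  rewrite /expi cosN sinN; case: es => ->; rewrite ?mul1r ?mulN1r ?cosN ?sinN;
  by apply/eqP; rewrite eq_complex /=; apply/andP; split; apply/eqP; ring.
have II : e%:C * 'i%C * (e%:C * 'i%C) = -1.
  rewrite mulrACA -expr2 -(rmorphXn (real_complex R)) e1 mul1r.
  by apply/eqP; rewrite eq_complex /=; apply/andP; split; apply/eqP; ring.
rewrite (rmorphN (real_complex R)) /=; move: (expi _) (D _) (D _) II => E x y.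
move: (e%:C * _) (cos _)%:C (sin _)%:C => I C S II.
rewrite !(scalerBr, scalerDr) !scalerA opprD addrACA -!scalerBl.
rewrite -[X in _ = _ + X]scaleNr.
congr (_ *: _ + _ *: _); first by ring.
have -> : E * - S = E * S * (I * I) by rewrite II; ring.
by ring.
Qed.

End weight_vector.

(** The vector diag_gen h - e i sym_gen h has weight k - e, where k = e n is the
    extremal weight, and that weight space is 0.  Since sym_gen = 2 E - so2_gen and
    so2_gen acts on h by i k, this expresses pi(H) h through pi(E) h and h. *)
Lemma extremal_weight pos n h : discrete_series pos n dot U ->
  smooth_vectors U h -> isotypic U (if pos then n%:Z else - n%:Z) h ->
  pH h = ((if pos then 1 else -1) * (rt2%:C * 'i%C)) *: pE h +
         (n%:R / rt2)%:C *: h.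
Proof.
move=> [_ _ HK] sh hk; have [D hD] := orbit_tangent_ex dotE HU sh.
(* The sign e is that of the extremal weight. *)
pose e : R := if pos then 1 else -1.
have e1 : e ^+ 2 = 1 by rewrite /e; case: ifP => _; rewrite ?sqrrN expr1n.
set k : int := if pos then _ else _ in hk.
have kn : k%:~R = e * n%:R :> R.
  by rewrite /k /e; case: ifP => _; rewrite ?mulrNz ?mulN1r ?mul1r.
have z0 : D diag_gen = (e%:C * 'i%C) *: D sym_gen.
  apply/eqP; rewrite -subr_eq0; apply/eqP.
  have := weight_shift hk hD e1; set z := _ - _ => Hz.
  have : isotypic U (k - (if pos then 1 else -1)) z.
    move=> theta; rewrite Hz intrB; congr (expi ((_ - _) * _) *: _).
    by rewrite /e; case: ifP.
  rewrite /k; case: (pos) HK => -[_ HK]; rewrite HK //.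
    by rewrite ltrBlDr ltrDl.
  by rewrite opprK ltrDl.
have DH : pH h = D (H_mx R) by rewrite H_mxE; exact: derived_repE.
have DE : pE h = D (E_mx R) by rewrite E_mxE; exact: derived_repE.
rewrite DH DE H_mx_diag (tangentZ hD rt2^-1) z0 sym_genE (tangentD hD).
rewrite (tangentZ hD 2) (tangentZ hD (-1)).
rewrite (tangent_so2 hk hD) kn !scalerDr !scalerA.
have ec : (if pos then 1 else -1) = e%:C.
  by rewrite /e; case: ifP => _; rewrite ?(rmorphN1 (real_complex R)).
rewrite ec; congr (_ *: _ + _ *: _).
  have -> : rt2%:C = rt2^-1%:C * 2%:C.
    rewrite -(rmorphM (real_complex R)); congr (_%:C).
    have r2 : rt2 * rt2 = 2 by rewrite -expr2 sqr_sqrtr.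
    by apply: (mulfI (rt2_neq0 (R := R))); rewrite mulVKf ?rt2_neq0.
  by ring.
rewrite !(rmorphM (real_complex R)) (rmorphN1 (real_complex R)) /=.
have i2 : 'i%C * 'i%C = -1 :> R[i].
  by apply/eqP; rewrite eq_complex /=; apply/andP; split; apply/eqP; ring.
have e2 : e%:C * e%:C = 1 :> R[i] by rewrite -(rmorphM (real_complex R)) -expr2 e1.
transitivity (- (n%:R%:C * rt2^-1%:C * (e%:C * e%:C) * ('i%C * 'i%C)) : R[i]).
  by ring.
by rewrite i2 e2; ring.
Qed.

End lowest_weight.

(** * Decomposition of a complex by a homotopy *)

Section homotopy.
Context {K : pzRingType} {M : lmodType K}.
Variables (C : set M) (d delta p : M -> M).

Definition linear_on (f : M -> M) : Prop :=
  forall a x y, C x -> C y -> f (a *: x + y) = a *: f x + f y.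

Hypothesis C0 : C 0.
Hypothesis Clin : forall a x y, C x -> C y -> C (a *: x + y).
Hypothesis dC : forall x, C x -> C (d x).
Hypothesis deltaC : forall x, C x -> C (delta x).
Hypothesis pC : forall x, C x -> C (p x).
Hypothesis dlin : linear_on d.
Hypothesis deltalin : linear_on delta.
Hypothesis plin : linear_on p.
Hypothesis dd : forall x, C x -> d (d x) = 0.
Hypothesis dp : forall x, C x -> d (p x) = 0.
Hypothesis deltap : forall x, C x -> delta (p x) = 0.
Hypothesis deltadelta : forall x, C x -> delta (delta x) = 0.
Hypothesis homotopy : forall x, C x -> x = p x + (d (delta x) + delta (d x)).

Lemma linear_on0 f : linear_on f -> f 0 = 0.
Proof.
move=> flin; have := flin 1 0 0 C0 C0; rewrite !scale1r addr0 => E.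
by apply: (@addrI _ (f 0)); rewrite addr0 -E.
Qed.

Lemma linear_onD f x y : linear_on f -> C x -> C y -> f (x + y) = f x + f y.
Proof. by move=> flin Cx Cy; have := flin 1 x y Cx Cy; rewrite !scale1r. Qed.

Lemma C_add x y : C x -> C y -> C (x + y).
Proof. by move=> Cx Cy; rewrite -[x]scale1r; exact: Clin. Qed.

Lemma image_submod_closed f : linear_on f -> submod_closed [in f @` C].
Proof.
move=> flin; split; first by rewrite inE; exists 0 => //; exact: linear_on0.
move=> a u v; rewrite !inE => -[x Cx <-] [y Cy <-].
by exists (a *: x + y); [exact: Clin|rewrite flin].
Qed.

Lemma d_delta_d x : C x -> d (delta (d x)) = d x.
Proof.
move=> Cx; have Cd := dC Cx; have := homotopy Cx => /(congr1 d).
rewrite (linear_onD dlin (pC Cx)) ?dp ?add0r //; last by apply: C_add; auto.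
rewrite (linear_onD dlin) ?dd ?add0r //; by [|auto].
Qed.

Lemma delta_d_delta x : C x -> delta (d (delta x)) = delta x.
Proof.
move=> Cx; have Cd := dC Cx; have := homotopy Cx => /(congr1 delta).
rewrite (linear_onD deltalin (pC Cx)) ?deltap ?add0r //; last by apply: C_add; auto.
rewrite (linear_onD deltalin) ?deltadelta ?addr0 //; by [|auto].
Qed.

(** delta vanishes on im p, and d delta is the identity on im d. *)
Lemma direct_pd a b : C a -> C b -> p a + d b = 0 -> p a = 0 /\ d b = 0.
Proof.
move=> Ca Cb E.
have db : d b = 0.
  have /(congr1 delta) := E; rewrite (linear_onD deltalin); auto.
  rewrite deltap // add0r (linear_on0 deltalin) => /(congr1 d).
  by rewrite d_delta_d // (linear_on0 dlin).
by move: E; rewrite db addr0.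
Qed.

(** d vanishes on im p and im d, and delta d is the identity on im delta. *)
Lemma direct_pddelta a b e : C a -> C b -> C e -> p a + d b + delta e = 0 ->
  [/\ p a = 0, d b = 0 & delta e = 0].
Proof.
move=> Ca Cb Ce E.
have de : delta e = 0.
  have /(congr1 d) := E; rewrite !(linear_onD dlin); auto using C_add.
  rewrite dp // dd // !add0r (linear_on0 dlin) => /(congr1 delta).
  by rewrite delta_d_delta // (linear_on0 deltalin).
by move: E; rewrite de addr0 => /(direct_pd Ca Cb)[].
Qed.

Lemma kernel_decomposition x : C x -> d x = 0 -> x = p x + d (delta x).
Proof. by move=> Cx dx; rewrite {1}(homotopy Cx) dx (linear_on0 deltalin) addr0. Qed.

Lemma complex_dsum : internal_dsum (tnth [tuple p @` C; d @` C; delta @` C]) C.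
Proof.
have i3 (i : 'I_3) :
    [\/ i = ord0, i = lift ord0 ord0 | i = lift ord0 (lift ord0 ord0)].
  by case: i => [[|[|[|//]]] ?]; [apply: Or31|apply: Or32|apply: Or33];
    apply: val_inj.
split.
- move=> i; case: (i3 i) => ->; apply: image_submod_closed => //.
- apply/seteqP; split=> [x Cx|_ [x Bx <-]].
    exists (tnth [tuple p x; d (delta x); delta (d x)]).
      move=> i; case: (i3 i) => ->; rewrite /tnth /=;
        [exists x|exists (delta x)|exists (d x)]; auto.
    by rewrite !big_ord_recl big_ord0 addr0 /tnth /= -homotopy.
  rewrite !big_ord_recl big_ord0 addr0.
  have [a Ca <-] := Bx ord0; have [b Cb <-] := Bx (lift ord0 ord0).
  have [e Ce <-] := Bx (lift ord0 (lift ord0 ord0)).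
  by apply: C_add; auto; apply: C_add; auto.
- move=> x Bx; rewrite !big_ord_recl big_ord0 addr0 addrA.
  have [a Ca Ea] := Bx ord0; have [b Cb Eb] := Bx (lift ord0 ord0).
  have [e Ce Ee] := Bx (lift ord0 (lift ord0 ord0)).
  rewrite /= in Ea Eb Ee.
  rewrite -Ea -Eb -Ee => /(direct_pddelta Ca Cb Ce)[pa db de] i.
  by case: (i3 i) => ->; rewrite -?Ea -?Eb -?Ee.
Qed.

Lemma kernel_dsum :
  internal_dsum (tnth [tuple p @` C; d @` C]) [set x | C x /\ d x = 0].
Proof.
have i2 (i : 'I_2) : i = ord0 \/ i = lift ord0 ord0.
  by case: i => [[|[|//]] ?]; [left|right]; apply: val_inj.
split.
- move=> i; case: (i2 i) => ->; apply: image_submod_closed => //.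
- apply/seteqP; split=> [x [Cx dx]|_ [x Bx <-]].
    exists (tnth [tuple p x; d (delta x)]).
      by move=> i; case: (i2 i) => ->; rewrite /tnth /=;
        [exists x|exists (delta x)]; auto.
    by rewrite !big_ord_recl big_ord0 addr0 /tnth /= -kernel_decomposition.
  rewrite !big_ord_recl big_ord0 addr0.
  have [a Ca <-] := Bx ord0; have [b Cb <-] := Bx (lift ord0 ord0).
  split; first by apply: C_add; auto.
  by rewrite (linear_onD dlin) ?dp ?dd ?addr0; auto.
- move=> x Bx; rewrite !big_ord_recl big_ord0 addr0.
  have [a Ca Ea] := Bx ord0; have [b Cb Eb] := Bx (lift ord0 ord0).
  rewrite /= in Ea Eb.
  rewrite -Ea -Eb => /(direct_pd Ca Cb)[pa db] i.
  by case: (i2 i) => ->; rewrite -?Ea -?Eb.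
Qed.

Lemma coset_eq (B : set M) x y b : submod_closed [in B] -> B b ->
  y = x + b -> coset B x = coset B y.
Proof.
move=> [B0 Blin] Bb ->; apply/seteqP; split=> [_ [e Be <-]|_ [e Be <-]].
  exists (e - b); last by rewrite [e - b]addrC addrA addrK.
  have := Blin (-1) b e; rewrite !inE scaleN1r addrC; exact.
exists (b + e); last by rewrite addrA.
by have := Blin 1 b e; rewrite !inE scale1r; exact.
Qed.

(** Hom plays the role of the homogeneous elements of each degree; as p preserves
    them, the isomorphism respects degrees. *)
Lemma cohomology_iso (Hom : nat -> set M) :
  (forall q x, C x -> Hom q x -> Hom q (p x)) ->
  exists Phi : M -> set M,
    [/\ set_bij (p @` C) (quotient_space [set x | C x /\ d x = 0] (d @` C)) Phi,
        linear_into_quotient (p @` C) Phi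
      & forall q, Phi @` (p @` C `&` Hom q) =
          quotient_space ([set x | C x /\ d x = 0] `&` Hom q) (d @` C)].
Proof.
move=> pHom; have Bsub := image_submod_closed dlin.
have B0 : (d @` C) 0 by exists 0 => //; exact: linear_on0.
have cE x : C x -> d x = 0 -> coset (d @` C) (p x) = coset (d @` C) x.
  move=> Cx dx; apply: (coset_eq (b := d (delta x))) => //.
    by exists (delta x); auto.
  exact: kernel_decomposition.
exists (coset (d @` C)); split.
- split.
  + by move=> _ [x Cx <-]; exists (p x) => //; split; auto.
  + move=> _ _ /set_mem[x Cx <-] /set_mem[y Cy <-] E.
    have : coset (d @` C) (p y) (p x).
      by rewrite -E; exists 0; rewrite ?addr0.
    move=> [_ [b Cb <-]] Exy.
    have CN : C (-1 *: x + y) by exact: Clin.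
    have : p (-1 *: x + y) + d b = 0.
      by rewrite plin // scaleN1r -addrA Exy addNr.
    move=> /(direct_pd CN Cb)[]; rewrite plin // scaleN1r => /eqP.
    by rewrite addrC subr_eq0 => /eqP.
  + move=> _ [x [Cx dx] <-]; exists (p x); last exact: cE.
    by exists x.
- move=> a _ _ [x Cx <-] [y Cy <-]; apply/seteqP; split.
    move=> _ [b Bb <-]; exists (p x); first by exists 0; rewrite ?addr0.
    by exists (p y + b); [exists b|rewrite addrA].
  move=> _ [_ [b Bb <-]] [_ [b' Bb' <-]] <-.
  exists (a *: b + b'); last by rewrite scalerDr addrACA.
  by case: Bsub => _ /(_ a b b'); rewrite !inE; exact.
- move=> q; apply/seteqP; split.
    move=> _ [_ [[x Cx <-] Hq] <-]; exists (p x) => //; split => //; split; auto.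
  move=> _ [x [[Cx dx] Hq] <-]; exists (p x); last exact: cE.
  by split; [exists x|exact: pHom].
Qed.

End homotopy.

(** * Forms on the Lie algebra an *)

Section an_coordinates.
Context {R : realType}.
Implicit Types (X Y : an R).

Lemma an_basis_free : free (an_basis R).
Proof.
apply/freeP => k; rewrite !big_ord_recl big_ord0 addr0 /= => E.
have E1 : k ord0 = 0.
  move/matrixP/(_ 0 0) : E; rewrite !mxE /= !(mulr0, mulr1, addr0) => /eqP.
  by rewrite mulf_eq0 invr_eq0 mulf_eq0 pnatr_eq0 /= (negPf rt2_neq0) orbF => /eqP.
have E2 : k (lift ord0 ord0) = 0.
  move/matrixP/(_ 0 1) : E; rewrite !mxE /= !(mulr0, mulr1, add0r) => /eqP.
  by rewrite mulf_eq0 invr_eq0 pnatr_eq0 orbF => /eqP.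
by move=> i; case: (unliftP ord0 i) => [j ->|-> //]; rewrite ord1.
Qed.

Lemma vsval_lin a X Y : vsval (a *: X + Y) = a *: vsval X + vsval Y.
Proof. exact: (@linearP _ _ _ _ (@vsval _ _ (an_space R)) a X Y). Qed.

Lemma theta_H_lin a X Y : theta_H (a *: X + Y) = a * theta_H X + theta_H Y.
Proof. by rewrite /theta_H vsval_lin linearP. Qed.

Lemma theta_E_lin a X Y : theta_E (a *: X + Y) = a * theta_E X + theta_E Y.
Proof. by rewrite /theta_E vsval_lin linearP. Qed.

Lemma theta_HZ a X : theta_H (a *: X) = a * theta_H X.
Proof.
have := theta_H_lin a X 0.
by rewrite addr0 /theta_H [vsval 0](_ : _ = 0) // linear0 addr0.
Qed.

Lemma theta_EZ a X : theta_E (a *: X) = a * theta_E X.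
Proof.
have := theta_E_lin a X 0.
by rewrite addr0 /theta_E [vsval 0](_ : _ = 0) // linear0 addr0.
Qed.

Lemma H_in : H_mx R \in an_space R.
Proof. by apply: memv_span; rewrite !inE eqxx. Qed.

Lemma E_in : E_mx R \in an_space R.
Proof. by apply: memv_span; rewrite !inE eqxx orbT. Qed.

Lemma vsval_H : vsval (H_an R) = H_mx R.
Proof. by rewrite vsprojK // H_in. Qed.

Lemma vsval_E : vsval (E_an R) = E_mx R.
Proof. by rewrite vsprojK // E_in. Qed.

Lemma theta_HE : theta_H (E_an R) = 0.
Proof. by rewrite /theta_H vsval_E; apply: (coord_free 1 0 an_basis_free). Qed.

Lemma theta_EE : theta_E (E_an R) = 1.
Proof. by rewrite /theta_E vsval_E; exact: (coord_free 1 1 an_basis_free). Qed.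

Lemma vsval_an X : vsval X = theta_H X *: H_mx R + theta_E X *: E_mx R.
Proof.
rewrite {1}(coord_span (valP X)) !big_ord_recl big_ord0 addr0 /theta_H /theta_E.
by congr (coord _ _ _ *: _ + coord _ _ _ *: _); apply: val_inj.
Qed.

Lemma an_eta X : X = theta_H X *: H_an R + theta_E X *: E_an R.
Proof.
apply: val_inj; rewrite -[LHS]/(vsval X) -[RHS]/(vsval (_ *: _ + _)).
have -> : theta_E X *: E_an R = theta_E X *: E_an R + 0 by rewrite addr0.
by rewrite !vsval_lin vsval_H vsval_E [vsval 0](_ : _ = 0) // addr0 vsval_an.
Qed.

(** The value of theta_H /\ theta_E on (X, Y). *)
Definition area X Y : R := theta_H X * theta_E Y - theta_E X * theta_H Y.

Lemma an_bracketE X Y :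
  an_bracket X Y = (area X Y * (Num.sqrt 2)^-1) *: E_an R.
Proof.
rewrite /E_an -linearZ /=; congr (vsproj _ _).
rewrite !vsval_an H_mxE E_mxE /upper !mx2Z !mx2D !mx2M.
rewrite -[- mx2 _ _ _ _]scaleN1r !mx2Z !mx2D.
have r0 := rt2_neq0 (R := R).
by congr (mx2 _ _ _ _); rewrite /area; field.
Qed.

End an_coordinates.

Section forms_on_an.
Context {R : realType} {V : lmodType R[i]}.
Implicit Types (X Y Z : an R) (v : V) (s : seq (an R)).
Local Notation H := (H_an R).
Local Notation E := (E_an R).

(** The cochain with values f0 on the empty sequence, fH on H, fE on E and f2 on
    (H, E).  Longer sequences get 0, as an has dimension 2. *)
Definition form (f0 fH fE f2 : V) s : V :=
  match s with
  | [::] => f0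
  | [:: X] => (theta_H X)%:C *: fH + (theta_E X)%:C *: fE
  | [:: X; Y] => (area X Y)%:C *: f2
  | _ => 0
  end.

Lemma form_lin a f0 fH fE f2 g0 gH gE g2 :
  a *: form f0 fH fE f2 + form g0 gH gE g2 =
  form (a *: f0 + g0) (a *: fH + gH) (a *: fE + gE) (a *: f2 + g2).
Proof.
apply/funext => -[|X [|Y [|Z s]]]; rewrite -[LHS]/(a *: _ + _) /= ?scaler0 ?addr0 //.
  rewrite !scalerDr !scalerA [a * _]mulrC [a * (theta_E X)%:C]mulrC.
  by rewrite addrACA -!scalerA.
by rewrite scalerDr !scalerA mulrC.
Qed.

Lemma form0 : form 0 0 0 0 = 0.
Proof.
by apply/funext => -[|X [|Y [|Z s]]] //=; rewrite !scaler0 ?addr0.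
Qed.

Lemma scaler_realD (a b : R) v : (a + b)%:C *: v = a%:C *: v + b%:C *: v.
Proof. by rewrite (rmorphD (real_complex R)) scalerDl. Qed.

Lemma scaler_realN (a : R) v : (- a)%:C *: v = - (a%:C *: v).
Proof. by rewrite (rmorphN (real_complex R)) scaleNr. Qed.

Lemma scaler_realM (a b : R) v : (a * b)%:C *: v = a%:C *: (b%:C *: v).
Proof. by rewrite (rmorphM (real_complex R)) scalerA. Qed.

Lemma areaDl a X Y Z : area (a *: X + Y) Z = a * area X Z + area Y Z.
Proof. by rewrite /area theta_H_lin theta_E_lin; ring. Qed.

Lemma areaDr a X Y Z : area Z (a *: X + Y) = a * area Z X + area Z Y.
Proof. by rewrite /area theta_H_lin theta_E_lin; ring. Qed.

Lemma form_cochain (W : set V) f0 fH fE f2 : W 0 ->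
  (forall a u v, W u -> W v -> W (a *: u + v)) ->
  W f0 -> W fH -> W fE -> W f2 -> cochains W (form f0 fH fE f2).
Proof.
move=> W0 Wl W0' WH WE W2.
have Wz a u : W u -> W (a *: u) by move=> Wu; rewrite -[_ *: u]addr0; exact: Wl.
split.
- move=> [|Z [|Z' s1]] s2 a X Y /=.
  + case: s2 => [|Z [|Z' s2]] /=; last by rewrite scaler0 addr0.
      rewrite theta_H_lin theta_E_lin !scaler_realD !scaler_realM scalerDr.
      by rewrite addrACA.
    by rewrite areaDl scaler_realD scaler_realM.
  + case: s2 => [|Z' s2] /=; last by rewrite scaler0 addr0.
    by rewrite areaDr scaler_realD scaler_realM.
  + by case: s1 => [|? ?] /=; rewrite scaler0 addr0.
- move=> [|X [|Y [|Z s]]] //=; rewrite inE andbT negbK => /eqP ->.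
  by rewrite /area mulrC subrr scale0r.
- move=> [|X [|Y [|Z s]]] //=; last exact: Wz.
  by apply: Wl => //; exact: Wz.
Qed.

(** Expanding the first arguments in the basis leaves, in length 3 or more, only
    terms in which H or E is repeated. *)
Lemma cochain_formE (W : set V) (c : seq (an R) -> V) : cochains W c ->
  c = form (c [::]) (c [:: H]) (c [:: E]) (c [:: H; E]).
Proof.
move=> [cm ca _].
have c0 s1 s2 : c (s1 ++ 0 :: s2) = 0.
  have := cm s1 s2 1 0 0; rewrite scaler0 addr0 !scale1r => e.
  by apply: (@addrI _ (c (s1 ++ 0 :: s2))); rewrite addr0 -e.
have cZ s1 s2 a X : c (s1 ++ (a *: X) :: s2) = a%:C *: c (s1 ++ X :: s2).
  by have := cm s1 s2 a X 0; rewrite c0 !addr0.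
have cX s1 s2 X : c (s1 ++ X :: s2) =
    (theta_H X)%:C *: c (s1 ++ H :: s2) + (theta_E X)%:C *: c (s1 ++ E :: s2).
  by rewrite {1}(an_eta X) cm cZ.
have cxx X s : c (X :: X :: s) = 0 by apply: ca; rewrite /= inE eqxx.
have cEH s : c (E :: H :: s) = - c (H :: E :: s).
  have := cxx (1 *: H + E) s; rewrite (cm [::]) /= (cm [:: H]) (cm [:: E]) /=.
  by rewrite !cxx !scale1r add0r addr0 => /eqP; rewrite addrC addr_eq0 => /eqP.
have c2 X Y s : c (X :: Y :: s) = (area X Y)%:C *: c (H :: E :: s).
  rewrite (cX [::]) /= (cX [:: H] s Y) (cX [:: E] s Y) /= !cxx !scaler0 addr0 add0r.
  rewrite cEH scalerN scalerN !scalerA -!(rmorphM (real_complex R)) -scalerBl.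
  by rewrite -(rmorphB (real_complex R)).
have cyc s : c (H :: E :: H :: s) = 0 by apply: ca; rewrite /= !inE eqxx orbT.
have cyc' s : c (H :: E :: E :: s) = 0.
  by apply: ca; rewrite /= !inE eqxx andbF.
apply/funext => -[|X [|Y [|Z s]]] //=.
  exact: (cX [::] [::] X).
by rewrite c2 (cX [:: H; E]) /= cyc cyc' !scaler0 addr0 scaler0.
Qed.

Section differential_of_forms.
Variables (W : set V) (rho : an R -> V -> V) (rhoH rhoE : V -> V) (c : R).
Hypothesis W0 : W 0.
Hypothesis Wlin : forall a u v, W u -> W v -> W (a *: u + v).
Hypothesis rho_an : forall X v, W v ->
  rho X v = (theta_H X)%:C *: rhoH v + (theta_E X)%:C *: rhoE v.
Hypothesis rhoHlin : forall a u v, W u -> W v ->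
  rhoH (a *: u + v) = a *: rhoH u + rhoH v.
Hypothesis rhoElin : forall a u v, W u -> W v ->
  rhoE (a *: u + v) = a *: rhoE u + rhoE v.

Lemma rho_lin X a u v : W u -> W v ->
  rho X (a *: u + v) = a *: rho X u + rho X v.
Proof.
move=> Wu Wv; rewrite !rho_an //; last exact: Wlin.
rewrite rhoHlin // rhoElin // !scalerDr !scalerA addrACA.
by rewrite [a * _]mulrC [a * (theta_E X)%:C]mulrC.
Qed.

Lemma rho_0 X : rho X 0 = 0.
Proof.
have := rho_lin X 1 W0 W0; rewrite !scale1r addr0 => e.
by apply: (@addrI _ (rho X 0)); rewrite addr0 -e.
Qed.

Lemma W_Z a u : W u -> W (a *: u).
Proof. by move=> Wu; rewrite -[a *: u]addr0; exact: Wlin. Qed.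

Lemma rho_Z X a u : W u -> rho X (a *: u) = a *: rho X u.
Proof. by move=> Wu; have := rho_lin X a Wu W0; rewrite rho_0 !addr0. Qed.

(** In length 3 the terms with rho and those with the bracket cancel separately, by
    the linear dependence of three vectors in a plane; in length 4 or more every
    term evaluates the form on at least 3 arguments. *)
Lemma ce_diff_form (f0 fH fE f2 : V) : W f0 -> W fH -> W fE -> W f2 ->
  ce_diff (fun X Y => (area X Y * c) *: E) rho (form f0 fH fE f2) =
  form 0 (rhoH f0) (rhoE f0) (rhoH fE - rhoE fH - c%:C *: fE).
Proof.
have b1 : bump 0 0 = 1%N by [].
have b2 : bump 0 1 = 2%N by [].
move=> Wf0 WfH WfE Wf2; apply/funext => -[|X [|Y [|Z s]]]; rewrite /ce_diff.
- by rewrite !big_ord0 addr0.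
- rewrite !big_ord_recl !big_ord0 /= expr0 scale1r !addr0.
  rewrite big_pred0 ?addr0; first exact: rho_an.
  by case=> -[].
- under [X in _ + X]eq_bigr do rewrite big_mkcond !big_ord_recl big_ord0 /=.
  rewrite !big_ord_recl !big_ord0 /= /del /= !addr0 add0r b1 add0n expr0 expr1.
  rewrite scale1r !scaleN1r.
  pose P w x y z := (w%:C *: rhoH fH + x%:C *: rhoH fE) +
    (y%:C *: rhoE fH + z%:C *: rhoE fE).
  have rhoP X' (a b : R) : rho X' (a%:C *: fH + b%:C *: fE) =
      P (theta_H X' * a) (theta_H X' * b) (theta_E X' * a) (theta_E X' * b).
    rewrite rho_lin // ?rho_Z //; last exact: W_Z.
    rewrite !rho_an // !scalerDr addrACA /P -!scaler_realM.
    by rewrite ![a * _]mulrC ![b * _]mulrC.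
  have PB w x y z w' x' y' z' : P w x y z - P w' x' y' z' =
      P (w - w') (x - x') (y - y') (z - z').
    have sub2 (t u t' u' : V) : t + u - (t' + u') = (t - t') + (u - u').
      by rewrite opprD addrACA.
    by rewrite /P !sub2 -!scalerBl -!(rmorphB (real_complex R)).
  have tH (k : R) : theta_H (k *: E) = 0.
    by rewrite theta_HZ theta_HE mulr0.
  have tE (k : R) : theta_E (k *: E) = k.
    by rewrite theta_EZ theta_EE mulr1.
  rewrite tH tE scale0r add0r !rhoP PB /P.
  rewrite [theta_H Y * theta_H X]mulrC [theta_E Y * theta_E X]mulrC !subrr.
  rewrite !scale0r add0r addr0 !scalerBr scaler_realM.
  congr (_ + _ - _).
    by rewrite [theta_H Y * _]mulrC.
  by rewrite -scaleNr -(rmorphN (real_complex R)) /area opprB [theta_E Y * _]mulrC.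
- case: s => [|T s].
    under [X in _ + X]eq_bigr do rewrite big_mkcond !big_ord_recl big_ord0 /=.
    rewrite !big_ord_recl !big_ord0 /= /del /= !addr0 !add0r b1 b2 !add0n.
    rewrite (_ : (1 + 2 = 3)%N) // expr0 expr1 sqrrN expr1n exprS sqrrN expr1n mulr1.
    rewrite !scale1r !scaleN1r !rho_Z // !rho_an //.
    have areaE (k : R) X' : area (k *: E) X' = - (k * theta_H X').
      by rewrite /area theta_HZ theta_EZ theta_HE theta_EE; ring.
    rewrite !areaE -!scaler_realN -!scaler_realD.
    rewrite [X in _ + X](_ : _ = 0) ?addr0; last first.
      apply/eqP; rewrite scaler_eq0; apply/orP; left; apply/eqP.
      by rewrite -(rmorph0 (real_complex R)); congr (_%:C); rewrite /area; ring.
    rewrite !scalerDr -!scaler_realM.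
    have sum3 (x1 y1 x2 y2 x3 y3 : V) : x1 + y1 + (x2 + y2 + (x3 + y3)) =
        x1 + (x2 + x3) + (y1 + (y2 + y3)).
      by rewrite (addrACA x2) (addrACA x1).
    rewrite sum3 -!scaler_realD.
    rewrite [X in X%:C *: _](_ : _ = 0) ?[X in _ + X%:C *: _](_ : _ = 0).
    + by rewrite !scale0r addr0.
    + by rewrite /area; ring.
    + by rewrite /area; ring.
  rewrite big1 => [|i _]; last first.
    by case: i => [[|[|[|[|i]]]] ilt] /=; rewrite ?rho_0 ?scaler0 //.
  rewrite add0r big1 // => i _; rewrite big1 // => j _.
  by case: i => [[|[|[|[|i]]]] ilt]; case: j => [[|[|[|[|j]]]] jlt] /=;
    rewrite ?scaler0.
Qed.

End differential_of_forms.

Lemma interior_form (f0 fH fE f2 : V) :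
  Defs.interior E (form f0 fH fE f2) = form fE (- f2) 0 0.
Proof.
apply/funext => -[|X [|Y [|Z s]]]; rewrite /Defs.interior /= ?scaler0 ?addr0 //.
  by rewrite theta_HE theta_EE scale0r add0r scale1r.
by rewrite /area theta_HE theta_EE mul0r mul1r sub0r scaler_realN scalerN.
Qed.

End forms_on_an.

(** * The complex of a discrete series *)

Section discrete_series_complex.
Context {R : realType} {V : completeNormedModType R[i]}.
Variables (dot : {dot V for @conjc R}) (U : 'M[R]_2 -> V -> V).
Variables (pos : bool) (n : nat) (phi : V -> R[i]) (h : V).
Local Notation W := (smooth_vectors U).
Local Notation rt2 := (Num.sqrt 2 : R).
Local Notation pH := (derived_rep U (H_mx R)).
Local Notation pE := (derived_rep U (E_mx R)).
Hypothesis dotE : norm_from_dot dot.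
Hypothesis n_gt0 : (1 <= n)%N.
Hypothesis HD : discrete_series pos n dot U.
Hypothesis philin : linear_form_on W phi.
Hypothesis kerphi : [set f | W f /\ phi f = 0] = pE @` W.
Hypothesis phiH : forall f, W f ->
  dual_action U (H_mx R) phi f = - (n%:R / rt2)%:C * phi f.
Hypothesis sh : W h.
Hypothesis hk : isotypic U (if pos then n%:Z else - n%:Z) h.
Hypothesis phih : phi h = 1.

Local Opaque H_mx E_mx.

Let HU : unitary_rep_PSL2 dot U. Proof. by case: HD. Qed.

Variables lam kap : R[i].
Hypothesis lamE : lam = ((1 - n%:R) / rt2)%:C.
Hypothesis kapE : kap = (if pos then 1 else -1) * (rt2%:C * 'i%C).
Let T := op_T U phi h.
Let rhoH v := pH v + lam *: v.
Let C := an_complex U.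
Let d := an_diff U lam.
Let delta := op_delta U phi h.
Let p := op_p pos phi h.

Let W0 : W 0. Proof. exact: smooth0 HU. Qed.
Let Wlin a u v : W u -> W v -> W (a *: u + v).
Proof. by move=> Wu Wv; exact: (smooth_lin HU). Qed.
Let WZ a u : W u -> W (a *: u).
Proof. by move=> Wu; exact: (smoothZ HU). Qed.
Let WpE v : W v -> W (pE v).
Proof. by move=> Wv; exact: (smooth_pE dotE HU). Qed.
Let WpH v : W v -> W (pH v).
Proof. by move=> Wv; exact: (smooth_pH dotE HU). Qed.
Let WrhoH v : W v -> W (rhoH v).
Proof. by move=> Wv; apply: (smoothD HU); [exact: WpH|exact: WZ]. Qed.

Let pElin a u v : W u -> W v -> pE (a *: u + v) = a *: pE u + pE v.
Proof. by move=> Wu Wv; rewrite E_mxE; exact: (derived_rep_lin dotE HU). Qed.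

Let pE0 : pE 0 = 0.
Proof.
have := pElin 1 W0 W0; rewrite !scale1r addr0 => e.
by apply: (@addrI _ (pE 0)); rewrite addr0 -e.
Qed.

Let pEZ a u : W u -> pE (a *: u) = a *: pE u.
Proof. by move=> Wu; have := pElin a Wu W0; rewrite pE0 !addr0. Qed.

Let pED u v : W u -> W v -> pE (u + v) = pE u + pE v.
Proof. by move=> Wu Wv; have := pElin 1 Wu Wv; rewrite !scale1r. Qed.

Let pEB u v : W u -> W v -> pE (u - v) = pE u - pE v.
Proof. by move=> Wu Wv; rewrite addrC -scaleN1r pElin // scaleN1r addrC. Qed.

Let pHlin a u v : W u -> W v -> pH (a *: u + v) = a *: pH u + pH v.
Proof. by move=> Wu Wv; rewrite H_mxE; exact: (derived_rep_lin dotE HU). Qed.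

Let rhoHlin a u v : W u -> W v -> rhoH (a *: u + v) = a *: rhoH u + rhoH v.
Proof.
move=> Wu Wv; rewrite /rhoH pHlin // !scalerDr addrACA !scalerA.
by rewrite [lam * a]mulrC.
Qed.

Let rhoH0 : rhoH 0 = 0.
Proof.
have := rhoHlin 1 W0 W0; rewrite !scale1r addr0 => e.
by apply: (@addrI _ (rhoH 0)); rewrite addr0 -e.
Qed.

Let rhoHZ a u : W u -> rhoH (a *: u) = a *: rhoH u.
Proof. by move=> Wu; have := rhoHlin a Wu W0; rewrite rhoH0 !addr0. Qed.

Let rhoHB u v : W u -> W v -> rhoH (u - v) = rhoH u - rhoH v.
Proof. by move=> Wu Wv; rewrite addrC -scaleN1r rhoHlin // scaleN1r addrC. Qed.

Let pE_inj u v : W u -> W v -> pE u = pE v -> u = v.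
Proof.
move=> Wu Wv E; apply/eqP; rewrite -subr_eq0; apply/eqP.
apply: (pE_injective dotE HU) => //.
- case: HD => _ _; case: (pos) => -[_]; apply; first by rewrite ltz_nat.
  by rewrite oppr_lt0 ltz_nat.
- exact: (smoothB HU).
- by rewrite addrC -scaleN1r pElin // E scaleN1r addNr.
Qed.

Let phi0 : phi 0 = 0.
Proof.
have := philin 1 W0 W0; rewrite scale1r addr0 mul1r => e.
by apply: (@addrI _ (phi 0)); rewrite addr0 -e.
Qed.

Let phiZ a u : W u -> phi (a *: u) = a * phi u.
Proof. by move=> Wu; have := philin a Wu W0; rewrite phi0 !addr0. Qed.

Let phi_pE v : W v -> phi (pE v) = 0.
Proof.
move=> Wv; have : (pE @` W) (pE v) by exists v.
by rewrite -kerphi => -[].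
Qed.

Let phi_pH v : W v -> phi (pH v) = (n%:R / rt2)%:C * phi v.
Proof. by move=> /phiH; rewrite /dual_action mulNr => /oppr_inj. Qed.

(** The vector f - phi(f) h lies in ker phi, which is the range of pi(E). *)
Let T_spec f : W f -> W (T f) /\ pE (T f) = f - phi f *: h.
Proof.
move=> Wf; apply: (@xgetPex _ 0 [set w | W w /\ pE w = f - phi f *: h]).
have : [set f | W f /\ phi f = 0] (f - phi f *: h).
  split; first by apply: (smoothB HU) => //; exact: WZ.
  by rewrite addrC -scaleNr philin // phih mulr1 addNr.
by rewrite kerphi => -[w Ww <-]; exists w.
Qed.

Let T_unique f w : W f -> W w -> pE w = f - phi f *: h -> T f = w.
Proof.
by move=> Wf Ww E; have [WT ET] := T_spec Wf; apply: pE_inj; rewrite // ET.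
Qed.

Let Tlin a u v : W u -> W v -> T (a *: u + v) = a *: T u + T v.
Proof.
move=> Wu Wv; have [WTu Eu] := T_spec Wu; have [WTv Ev] := T_spec Wv.
apply: T_unique; [exact: Wlin|exact: Wlin|].
rewrite pElin // Eu Ev philin // scalerBr scalerA scalerDl opprD addrACA.
by [].
Qed.

Let T0 : T 0 = 0.
Proof.
by apply: T_unique => //; rewrite phi0 scale0r subr0.
Qed.

Let TZ a u : W u -> T (a *: u) = a *: T u.
Proof. by move=> Wu; have := Tlin a Wu W0; rewrite T0 !addr0. Qed.

Let Th : T h = 0.
Proof.
by apply: T_unique => //; rewrite phih scale1r subrr.
Qed.

Let T_pE v : W v -> T (pE v) = v.
Proof.
by move=> Wv; apply: T_unique => //; [exact: WpE|rewrite phi_pE // scale0r subr0].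
Qed.

Let rho_an X v : W v ->
  an_action U lam X v = (theta_H X)%:C *: rhoH v + (theta_E X)%:C *: pE v.
Proof.
move=> Wv; rewrite /an_action /rhoH scalerDr scalerA addrAC [lam * _]mulrC.
congr (_ + _).
have -> : vsval X =
    upper (theta_H X * (2 * rt2)^-1 + 0) (theta_H X * 0 + theta_E X / 2).
  rewrite vsval_an H_mxE E_mxE /upper !mx2Z mx2D.
  by congr (mx2 _ _ _ _); ring.
rewrite (derived_rep_upper dotE HU) // (derived_rep_nil dotE HU) // -H_mxE.
congr (_ + _%:C *: _).
by rewrite mulrCA divff ?mulr1 // pnatr_eq0.
Qed.

Let formC f0 fH fE f2 : W f0 -> W fH -> W fE -> W f2 -> C (form f0 fH fE f2).
Proof. by move=> *; apply: form_cochain => // *; exact: Wlin. Qed.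

Let C_ind (P : (seq (an R) -> V) -> Prop) :
  (forall f0 fH fE f2, W f0 -> W fH -> W fE -> W f2 -> P (form f0 fH fE f2)) ->
  forall c, C c -> P c.
Proof.
by move=> HP c Cc; rewrite (cochain_formE Cc); case: Cc => _ _ Wc; apply: HP.
Qed.

Let C_form c : C c -> exists f0 fH fE f2,
  [/\ W f0, W fH, W fE, W f2 & c = form f0 fH fE f2].
Proof. by elim/C_ind => f0 fH fE f2 *; exists f0, fH, fE, f2. Qed.

Let d_form f0 fH fE f2 : W f0 -> W fH -> W fE -> W f2 ->
  d (form f0 fH fE f2) =
  form 0 (rhoH f0) (pE f0) (rhoH fE - pE fH - rt2^-1%:C *: fE).
Proof.
move=> Wf0 WfH WfE Wf2; rewrite /d /an_diff.
have -> : @an_bracket R = fun X Y => (area X Y * rt2^-1) *: E_an R.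
  by apply/funext => X; apply/funext => Y; rewrite an_bracketE.
exact: (@ce_diff_form R V W (an_action U lam) rhoH pE rt2^-1 W0 Wlin rho_an
  rhoHlin pElin).
Qed.

Let delta_form f0 fH fE f2 : W f0 -> W fH -> W fE -> W f2 ->
  delta (form f0 fH fE f2) = form (T fE) (- T f2) 0 0.
Proof.
move=> W0' WH WE W2; rewrite /delta /op_delta interior_form.
apply/funext => -[|X [|Y [|Z s]]]; rewrite /on_values /= ?scaler0 ?addr0 //.
by rewrite -/T !scalerN -!scaleNr TZ.
Qed.

Let p_form f0 fH fE f2 : W f0 -> W fH -> W fE -> W f2 ->
  p (form f0 fH fE f2) = form 0 ((kap * phi fE) *: h) (phi fE *: h) (phi f2 *: h).
Proof.
move=> W0' WH WE W2; rewrite /p /op_p interior_form.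
have phiN : phi (- f2) = - phi f2 by rewrite -scaleN1r phiZ // mulN1r.
have b1 : bump 0 0 = 1%N by [].
apply/funext => -[|X [|Y [|Z s]]]; rewrite /exterior /on_values.
- by rewrite big_ord0.
- rewrite big_ord_recl big_ord0 /= expr0 scale1r addr0 !scalerA -scalerDl.
  congr (_ *: _); rewrite /theta_pm -kapE; ring.
- rewrite !big_ord_recl big_ord0 /= /del /= b1 expr0 expr1 !scaler0 !addr0.
  rewrite !phiZ ?phiN; try by rewrite -scaleN1r; exact: WZ.
  rewrite scale1r scaleN1r !scalerA -scalerBl; congr (_ *: _).
  rewrite /theta_pm -kapE /area (rmorphB (real_complex R)).
  rewrite !(rmorphM (real_complex R)) /=.
  by ring.
- rewrite big1 // => i _; rewrite [X in phi X](_ : _ = 0) ?phi0 ?scale0r ?scaler0 //.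
  case: i => [[|[|[|i]]] ilt] /=; rewrite ?scaler0 ?addr0 //;
  by case: s ilt.
Qed.

Let WT f : W f -> W (T f). Proof. by move=> /T_spec[]. Qed.
Let WN u : W u -> W (- u). Proof. by move=> Wu; rewrite -scaleN1r; exact: WZ. Qed.
Let Wd2 fH fE : W fH -> W fE -> W (rhoH fE - pE fH - rt2^-1%:C *: fE).
Proof.
move=> WH WE; apply: (smoothB HU); last exact: WZ.
by apply: (smoothB HU); [exact: WrhoH|exact: WpE].
Qed.
Let Wh a : W (a *: h). Proof. exact: WZ. Qed.

Let C0 : C 0.
Proof. by rewrite -form0; exact: formC. Qed.

Let Clin a x y : C x -> C y -> C (a *: x + y).
Proof.
move=> /C_form[f0 [fH [fE [f2 [? ? ? ? ->]]]]]
  /C_form[g0 [gH [gE [g2 [? ? ? ? ->]]]]].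
by rewrite form_lin; apply: formC; exact: Wlin.
Qed.

Let dC c : C c -> C (d c).
Proof.
by elim/C_ind => f0 fH fE f2 *; rewrite d_form //; apply: formC => //;
  [exact: WrhoH|exact: WpE|exact: Wd2].
Qed.

Let deltaC c : C c -> C (delta c).
Proof.
by elim/C_ind => f0 fH fE f2 *; rewrite delta_form //; apply: formC => //;
  [exact: WT|apply: WN; exact: WT].
Qed.

Let pC c : C c -> C (p c).
Proof. by elim/C_ind => f0 fH fE f2 *; rewrite p_form //; apply: formC. Qed.

Let dlin : linear_on C d.
Proof.
move=> a _ _ /C_form[f0 [fH [fE [f2 [? ? ? ? ->]]]]]
  /C_form[g0 [gH [gE [g2 [? ? ? ? ->]]]]].
rewrite form_lin !d_form //; try exact: Wlin; rewrite form_lin; congr form.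
- by rewrite scaler0 addr0.
- exact: rhoHlin.
- exact: pElin.
- rewrite rhoHlin // pElin // 2!scalerBr.
  have -> : rt2^-1%:C *: (a *: fE + gE) = a *: (rt2^-1%:C *: fE) + rt2^-1%:C *: gE.
    by rewrite scalerDr !scalerA [a * _]mulrC.
  have alg (a1 b1 a2 b2 a3 b3 : V) : a1 + b1 - (a2 + b2) - (a3 + b3) =
      (a1 - a2 - a3) + (b1 - b2 - b3).
    by rewrite !opprD (addrACA a1) (addrACA (a1 - a2)).
  exact: alg.
Qed.

Let deltalin : linear_on C delta.
Proof.
move=> a _ _ /C_form[f0 [fH [fE [f2 [? ? ? ? ->]]]]]
  /C_form[g0 [gH [gE [g2 [? ? ? ? ->]]]]].
rewrite form_lin !delta_form //; try exact: Wlin; rewrite form_lin; congr form.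
- exact: Tlin.
- by rewrite Tlin // opprD scalerN.
- by rewrite scaler0 addr0.
- by rewrite scaler0 addr0.
Qed.

Let plin : linear_on C p.
Proof.
move=> a _ _ /C_form[f0 [fH [fE [f2 [? ? ? ? ->]]]]]
  /C_form[g0 [gH [gE [g2 [? ? ? ? ->]]]]].
rewrite form_lin !p_form //; try exact: Wlin; rewrite form_lin !philin //.
congr form; rewrite ?scaler0 ?addr0 // ?mulrDr scalerDl !scalerA //.
by rewrite mulrCA.
Qed.

Let bracket f : W f -> pH (pE f) = rt2^-1%:C *: pE f + pE (pH f).
Proof. exact: bracket_HE. Qed.

Let dd c : C c -> d (d c) = 0.
Proof.
elim/C_ind => f0 fH fE f2 Wf0 *; rewrite d_form // d_form //;
  [|exact: WrhoH|exact: WpE|exact: Wd2].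
rewrite -[RHS]form0; congr form.
- exact: rhoH0.
- exact: pE0.
rewrite /rhoH bracket // [pH f0 + _]addrC pElin //; last exact: WpH.
have alg (x y l : V) : x + y + l - (l + y) - x = 0.
  by rewrite [l + y]addrC -[x + y + l]addrA addrK subrr.
exact: alg.
Qed.

(** The operator d maps the 1-form kappa theta_H + theta_E times h to 0. *)
Let extremal : rhoH h - pE (kap *: h) - rt2^-1%:C *: h = 0.
Proof.
rewrite pEZ //.
rewrite /rhoH (extremal_weight dotE HU HD sh hk) -kapE.
have alg (k a l b : V) : k + a + l - k - b = a + l - b.
  by rewrite -[k + a + l]addrA [k + (a + l)]addrC addrK.
rewrite alg -scalerDl -scalerBl lamE.
rewrite -(rmorphD (real_complex R)) -(rmorphB (real_complex R)).
have -> : n%:R / rt2 + (1 - n%:R) / rt2 - rt2^-1 = 0.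
  by field; exact: rt2_neq0.
exact: scale0r.
Qed.

Let dp c : C c -> d (p c) = 0.
Proof.
elim/C_ind => f0 fH fE f2 *; rewrite p_form // d_form // -[RHS]form0; congr form.
- exact: rhoH0.
- exact: pE0.
rewrite mulrC -scalerA rhoHZ // pEZ // scalerA [_ * phi fE]mulrC -scalerA.
by rewrite -!scalerBr extremal scaler0.
Qed.

Let deltap c : C c -> delta (p c) = 0.
Proof.
elim/C_ind => f0 fH fE f2 *; rewrite p_form // delta_form // -[RHS]form0.
by rewrite !TZ // Th !scaler0 oppr0.
Qed.

Let deltadelta c : C c -> delta (delta c) = 0.
Proof.
elim/C_ind => f0 fH fE f2 *; rewrite delta_form // delta_form //; last first.
- by apply: WN; exact: WT.
- exact: WT.
by rewrite T0 oppr0 form0.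
Qed.

Let formD f0 fH fE f2 g0 gH gE g2 :
  form f0 fH fE f2 + form g0 gH gE g2 = form (f0 + g0) (fH + gH) (fE + gE) (f2 + g2)
    :> (seq (an R) -> V).
Proof. by rewrite -[form f0 fH fE f2]scale1r form_lin !scale1r. Qed.

(** Applying pi(E), which is injective, reduces the claim to the bracket relation
    and to [extremal]; the right-hand side stems from the term phi(f) h by which
    pi(E) (T f) differs from f. *)
Let T_rhoH f : W f ->
  rhoH (T f) - T (rhoH f - rt2^-1%:C *: f) = - (kap * phi f) *: h.
Proof.
move=> Wf; have [WTf ETf] := T_spec Wf.
set g := rhoH f - _.
have Wg : W g by apply: (smoothB HU); [exact: WrhoH|exact: WZ].
have [WTg ETg] := T_spec Wg.
have phig : phi g = 0.
  rewrite /g /rhoH -scaleNr addrC philin //; last exact: WrhoH.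
  rewrite -[pH f]scale1r philin //; [|exact: WpH|exact: WZ].
  rewrite phi_pH // phiZ // mul1r lamE -!mulrDl -(rmorphN (real_complex R)).
  rewrite -!(rmorphD (real_complex R)).
  have -> : - rt2^-1 + (n%:R / rt2 + (1 - n%:R) / rt2) = 0.
    by field; exact: rt2_neq0.
  exact: mul0r.
have WrT : W (rhoH (T f)) by exact: WrhoH.
apply: pE_inj; [exact: (smoothB HU)|exact: Wh|].
have pErhoH u : W u -> pE (rhoH u) = rhoH (pE u) - rt2^-1%:C *: pE u.
  move=> Wu; rewrite /rhoH bracket // pED; [|exact: WpH|exact: WZ].
  by rewrite pEZ // -[_ + _ + lam *: _]addrA addrC addrK.
rewrite pEB // pErhoH // ETf ETg phig scale0r subr0.
rewrite rhoHB // ?rhoHZ //.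
rewrite scaleNr -scaleN1r pEZ // mulrC -scalerA pEZ //.
have -> : pE (kap *: h) = rhoH h - rt2^-1%:C *: h.
  by apply/esym/eqP; rewrite -subr_eq0 addrAC extremal.
rewrite scaleN1r /g !scalerBr !scalerA [phi f * _]mulrC.
have alg (a b c e : V) : a - b - (c - e) - (a - c) = - (b - e).
  by rewrite !opprB -addrA [e - c + _]addrA subrK addrC addrA subrK.
exact: alg.
Qed.

Let homotopy c : C c -> c = p c + (d (delta c) + delta (d c)).
Proof.
elim/C_ind => f0 fH fE f2 Wf0 WfH WfE Wf2.
have [WTE ETE] := T_spec WfE; have [WT2 ET2] := T_spec Wf2.
rewrite p_form // delta_form // d_form //; last exact: WN.
rewrite d_form // delta_form //; [|exact: WrhoH|exact: WpE|exact: Wd2].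
rewrite !formD; congr form.
- by rewrite !add0r T_pE.
- have Wg : W (rhoH fE - rt2^-1%:C *: fE).
    by apply: (smoothB HU); [exact: WrhoH|exact: WZ].
  have -> : T (rhoH fE - pE fH - rt2^-1%:C *: fE) =
      T (rhoH fE - rt2^-1%:C *: fE) - fH.
    rewrite addrAC [_ - pE fH]addrC -scaleN1r Tlin //; last exact: WpE.
    by rewrite T_pE // scaleN1r (addrC (- fH)).
  have := T_rhoH WfE; move: (T (rhoH fE - _)) (rhoH (T fE)) => t a E.
  by rewrite opprB (addrC fH) (addrA a) E scaleNr addrA subrr add0r.
- by rewrite addr0 ETE addrC subrK.
- have -> : pE (- T f2) = - pE (T f2).
    by rewrite -[- T f2]scaleN1r pEZ // scaleN1r.
  rewrite rhoH0 scaler0 subr0 add0r addr0 opprK ET2.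
  by rewrite addrC subrK.
Qed.

Lemma op_p_homogeneous q c : homogeneous q c -> homogeneous q (p c).
Proof.
move=> cq s sq; rewrite /p /op_p /exterior big1 // => i _.
rewrite /on_values /Defs.interior cq ?phi0 ?scale0r ?scaler0 //.
rewrite /del /= size_cat size_take size_drop ltn_ord.
have := ltn_ord i; move: sq; move: (size s) (nat_of_ord i) => m k.
by move=> sq km; rewrite -addnS -subSn // subSS subnKC // ltnW.
Qed.

Lemma discrete_series_decomposition :
  [/\ internal_dsum (tnth [tuple p @` C; d @` C; delta @` C]) C,
      internal_dsum (tnth [tuple p @` C; d @` C]) [set c | C c /\ d c = 0]
    & exists Phi : (seq (an R) -> V) -> set (seq (an R) -> V),
        [/\ set_bij (p @` C)
              (quotient_space [set c | C c /\ d c = 0] (d @` C)) Phi,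
            linear_into_quotient (p @` C) Phi
          & forall q : nat, Phi @` (p @` C `&` homogeneous q) =
              quotient_space ([set c | C c /\ d c = 0] `&` homogeneous q)
                (d @` C)]].
Proof.
split.
- exact: complex_dsum.
- by apply: (kernel_dsum (delta := delta)).
- by apply: (cohomology_iso (delta := delta)) => // q x _; exact: op_p_homogeneous.
Qed.

End discrete_series_complex.

Theorem theorem53 (R : realType) (V : completeNormedModType R[i])
    (dot : {dot V for @conjc R}) (U : 'M[R]_2 -> V -> V)
    (pos : bool) (n : nat) (phi : V -> R[i]) (h : V) :
  norm_from_dot dot ->
  (1 <= n)%N ->
  discrete_series pos n dot U ->
  linear_form_on (smooth_vectors U) phi ->
  [set f | smooth_vectors U f /\ phi f = 0] =
    derived_rep U (E_mx R) @` smooth_vectors U ->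
  (forall f, smooth_vectors U f ->
    dual_action U (H_mx R) phi f = - (n%:R / Num.sqrt 2)%:C * phi f) ->
  smooth_vectors U h ->
  isotypic U (if pos then n%:Z else - n%:Z) h ->
  phi h = 1 ->
  let C := an_complex U in
  let d := an_diff U ((1 - n%:R) / Num.sqrt 2)%:C in
  let im_d := d @` C in
  let im_delta := op_delta U phi h @` C in
  let im_p := op_p pos phi h @` C in
  let ker_d := [set c | C c /\ d c = 0] in
  [/\ internal_dsum (tnth [tuple im_p; im_d; im_delta]) C,
      internal_dsum (tnth [tuple im_p; im_d]) ker_d
    & exists Phi : (seq (an R) -> V) -> set (seq (an R) -> V),
        [/\ set_bij im_p (quotient_space ker_d im_d) Phi,
            linear_into_quotient im_p Phi
          & forall q : nat, Phi @` (im_p `&` homogeneous q) =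
              quotient_space (ker_d `&` homogeneous q) im_d]].
Proof.
move=> dotE n_gt0 HD philin kerphi phiH sh hk phih.
exact: (discrete_series_decomposition dotE n_gt0 HD philin kerphi phiH sh hk phih
  (erefl _) (erefl _)).
Qed.
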